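(* Let $(S,\Sigma,\mu)$ be an atomless probability space, let $T$ be a nonempty topological space, and let $L(S,T)$ be the set of all functions from $S$ to $T$ with the topology of pointwise convergence. Each compact and metrizable set $X\subseteq L(S,T)$ is a subset of a sequentially compact set $Y\subseteq L(S,T)$ that has the $\mu$-fixed point property.
   Context: $L(S,T)$ consists of all functions $S\to T$, not necessarily measurable, with the topology of pointwise convergence. A subset of $L(S,T)$ is metrizable if it is a metrizable topological space in the topology of pointwise convergence. For $E\in\Sigma$ and $f,g\in L(S,T)$, $g_Ef\in L(S,T)$ is the function with $g_Ef(s)=g(s)$ if $s\in E$ and $g_Ef(s)=f(s)$ if $s\in S\setminus E$. A subset $F\subseteq L(S,T)$ is decomposable if $g_Ef\in F$ for each $E\in\Sigma$ and $f,g\in F$. A set-valued (possibly empty valued) mapping $B\colon F\twoheadrightarrow F$ is a decomposable mapping if its domain $F$ and its values $B(f)$, for all $f\in F$, are decomposable subsets of $L(S,T)$. A decomposable mapping $B\colon F\twoheadrightarrow F$ is $\mu$-sequentially closed graphed if: (1) if $\mu(E)=0$ and $g\in B(f)$, then $h_Eg\in B(f)$ and $g\in B(h_Ef)$ for all $h\in F$; (2) $F$ is sequentially closed in $L(S,T)$; (3) $B$ has a sequentially closed graph in $F\times F$. A fixed point of $B$ is a function $f\in F$ with $f\in B(f)$. A subset $Y\subseteq L(S,T)$ has the $\mu$-fixed point property if every decomposable $\mu$-sequentially closed-graphed mapping $B\colon F\twoheadrightarrow F$ (for any $F\subseteq L(S,T)$) that satisfies (a) $Y\cap F\neq\emptyset$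 and (b) $Y\cap B(f)\neq\emptyset$ for all $f\in Y\cap F$, has a fixed point in $Y\cap F$. *)

(* Defs.v *)
From HB Require Import structures.
From mathcomp Require Import all_boot all_order all_algebra.
From mathcomp Require Import all_classical all_reals all_analysis.

Set Implicit Arguments.
Unset Strict Implicit.
Unset Printing Implicit Defensive.

Import Order.TTheory GRing.Theory Num.Theory.
Local Open Scope classical_set_scope.
Local Open Scope ring_scope.

Definition atomless (d : measure_display) (S : measurableType d) (R : realType)
    (mu : set S -> \bar R) : Prop :=
  forall A : set S, measurable A -> (0 < mu A)%E ->
    exists B : set S,
      [/\ measurable B, B `<=` A, (0 < mu B)%E & (mu B < mu A)%E].

Definition metrizable (R : realType) (X : topologicalType) : Prop :=
  exists dist : X -> X -> R,
    [/\ forall x y, dist x y = 0 <-> x = y,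
        forall x y, 0 <= dist x y,
        forall x y, dist x y = dist y x,
        forall x y z, dist x z <= dist x y + dist y z &
        forall x, nbhs x = nbhs_ball_ (fun x e => [set y | dist x y < e]) x].

(* Limits of sequences need not be unique: no separation is assumed. *)
Definition seq_closed_in (X : topologicalType) (D A : set X) : Prop :=
  forall (u : nat -> X) (x : X),
    (forall n, A (u n)) -> D x -> u @ \oo --> x -> A x.

Definition seq_compact (X : topologicalType) (A : set X) : Prop :=
  forall u : nat -> X, (forall n, A (u n)) ->
    exists2 phi : nat -> nat, increasing_seq phi &
      exists2 x : X, A x & (u \o phi) @ \oo --> x.

(* [patch f E g] is the function written $g_E f$: it equals g on E and f
   elsewhere. *)
Definition decomposable (d : measure_display) (S : measurableType d)
    (T : topologicalType) (F : set {ptws S -> T}) : Prop :=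
  forall (E : set S) (f g : {ptws S -> T}),
    measurable E -> F f -> F g -> F (patch f E g).

(* A set-valued mapping from F to F is a function on all of {ptws S -> T} of
   which only the values at points of F matter. *)
Definition decomposable_mapping (d : measure_display) (S : measurableType d)
    (T : topologicalType) (F : set {ptws S -> T})
    (B : {ptws S -> T} -> set {ptws S -> T}) : Prop :=
  [/\ forall f, F f -> B f `<=` F,
      decomposable F &
      forall f, F f -> decomposable (B f)].

Definition graph_on (X : Type) (F : set X) (B : X -> set X) : set (X * X) :=
  [set fg | F fg.1 /\ B fg.1 fg.2].

Definition seq_closed_graphed (d : measure_display) (S : measurableType d)
    (R : realType) (mu : set S -> \bar R) (T : topologicalType)
    (F : set {ptws S -> T}) (B : {ptws S -> T} -> set {ptws S -> T}) : Prop :=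
  [/\ forall (E : set S) (f g : {ptws S -> T}),
        measurable E -> mu E = 0%E -> F f -> B f g ->
        forall h : {ptws S -> T}, F h ->
          B f (patch g E h) /\ B (patch f E h) g,
      seq_closed_in setT F &
      seq_closed_in (F `*` F) (graph_on F B)].

Definition fixed_point_property (d : measure_display) (S : measurableType d)
    (R : realType) (mu : set S -> \bar R) (T : topologicalType)
    (Y : set {ptws S -> T}) : Prop :=
  forall (F : set {ptws S -> T}) (B : {ptws S -> T} -> set {ptws S -> T}),
    decomposable_mapping F B -> seq_closed_graphed mu F B ->
    Y `&` F !=set0 ->
    (forall f, (Y `&` F) f -> Y `&` B f !=set0) ->
    exists2 f, (Y `&` F) f & B f f.

(* Main.v *)
Require Import Defs.
From HB Require Import structures.
From mathcomp Require Import all_boot all_order all_algebra.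
From mathcomp Require Import all_classical all_reals all_analysis.
From mathcomp Require Import zify ring lra.

(** Why the theorem holds.

    Two parametrisations reduce it to monotone functions on the line. By the
    Alexandroff-Hausdorff theorem and the ternary embedding of the Cantor space
    into the reals, a nonempty compact metrizable X is E(K) for a closed subset
    K of [0, 1] and a map E that is pointwise sequentially continuous on K
    ([real_parametrisation]). Since mu is atomless, there is a measurable map u
    from S to [0, 1] all of whose level sets are null ([atomless_coordinate]).
    Let Y be the set of the functions s |-> E (m (u s)) s, where m is
    nondecreasing on the line with values in K. Constant m give X, and Helly's
    selection theorem makes Y sequentially compact.

    For the fixed points, let D be the set of the m whose function lies in F,
    and G(m) the set of the m' in the same family whose function lies in the
    value of B at the function of m. Decomposability makes D and each G(m)
    stable under monotone patching, and there is a patching that does the work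
    of convex combinations: given m_1, ..., m_r and thresholds th_1, ..., th_r,
    one of them nonpositive, the mix s |-> max {m_j(s) : th_j <= s} is
    nondecreasing and agrees with some m_j at each s >= 0 ([is_mix]).

    As in Kakutani's theorem, one chooses an element g_i of G(c_i) for each
    point c_i of a finite net of D, and looks for a mix m of the g_i in which
    each g_i that counts has its c_i close to m. The existence of such a mix is
    a labelling argument on a grid of the simplex ([simplex_labelling]), which
    rests on Scarf's combinatorial lemma rather than on a triangulation
    ([approximate_fixed_point]).

    In the limit the number of points of the net grows, and for general patches
    the errors would add up. Here they do not: closeness is measured in the
    Levy distance ([close]), and a mix of functions that are eta-close to the
    h_j is itself eta-close to the mix of the h_j, whatever their number
    ([mix_close]). Levy convergence to a nondecreasing m is pointwise
    convergence on (0, 1) outside the countably many jumps of m. The points that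
    u sends to these jumps or to 0 or 1 form a null set, on which functions may
    be altered by the assumptions on B. Together with the closed graph this
    gives a fixed point ([mix_fixed_point]). *)

Set Implicit Arguments.
Unset Strict Implicit.
Unset Printing Implicit Defensive.

Import Order.TTheory GRing.Theory Num.Theory.
Import numFieldNormedType.Exports.

Local Open Scope classical_set_scope.

(** * Scarf's combinatorial lemma *)

Section ScarfLemma.
(* Sets are finite sets in this section. *)
Import fintype finset.
Local Close Scope classical_set_scope.

Section Scarf.
Variables (V I : finType) (rk : I -> V -> nat) (sl : I -> V) (lab : V -> I).
Hypothesis rk_inj : forall i, injective (rk i).
Hypothesis labK : cancel sl lab.
Hypothesis sl_min : forall i v, rk i (sl i) <= rk i v.
Hypothesis sl_max : forall i j v, i != j -> v != sl (lab v) ->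
  rk i v < rk i (sl j).
Variable r0 : V.
Hypothesis r0P : r0 != sl (lab r0).

(** Points of [V] are compared by one ranking for each index. Besides ordinary
    points, [V] contains a slack point [sl i] for each index [i]: it is the
    lowest point for the ranking [i], and lies above all ordinary points for
    the other rankings. A set is undominated when no point exceeds, in every
    ranking, the lowest element of the set for that ranking. Undominated sets
    with #|I| elements are called rooms below, those with one element less
    doors. *)
Definition undominated (Z : {set V}) : bool :=
  [forall v, exists i, [forall z in Z, rk i v <= rk i z]].

Lemma undominatedP (Z : {set V}) :
  reflect (forall v, exists i, forall z, z \in Z -> rk i v <= rk i z)
          (undominated Z).
Proof.
apply: (iffP forallP) => H v.
  by have /existsP[i /forall_inP Hi] := H v; exists i.
by have [i Hi] := H v; apply/existsP; exists i; apply/forall_inP.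
Qed.

Lemma undominatedS (W Z : {set V}) :
  W \subset Z -> undominated Z -> undominated W.
Proof.
move=> /subsetP WZ /undominatedP H; apply/undominatedP => v.
by have [i Hi] := H v; exists i => z /WZ; exact: Hi.
Qed.

Lemma minimizers (W : {set V}) : W != finset.set0 ->
  exists f : I -> V,
    (forall i, f i \in W) /\ (forall i w, w \in W -> rk i (f i) <= rk i w).
Proof.
case/set0Pn => w0 w0W.
exists (fun i => [arg min_(w < w0 in W) rk i w]).
by split=> i; case: arg_minnP => // w wW H w' /H.
Qed.

(** In an undominated set each element is the lowest one for some ranking. *)
Lemma minimizer_onto (W : {set V}) (f : I -> V) : undominated W ->
  (forall i, f i \in W) -> (forall i w, w \in W -> rk i (f i) <= rk i w) ->
  forall w, w \in W -> exists i, f i = w.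
Proof.
move=> /undominatedP dW fW fmin w wW; have [i Hi] := dW w; exists i.
by apply: (@rk_inj i); apply/eqP; rewrite eqn_leq fmin// Hi.
Qed.

(** The points that complete [W] to an undominated set with one element more. *)
Definition completions (W : {set V}) : {set V} :=
  [set v | (v \notin W) && undominated (v |: W)].

(** A door is a wall between two rooms: exactly two rankings have the same
    lowest element in [W], and the new point must become the lowest one for
    either of them, which determines it. *)
Lemma completions_interior (W : {set V}) r :
  #|W|.+1 = #|I| -> undominated W -> r \in W -> r != sl (lab r) ->
  #|completions W| = 2.
Proof.
move=> cW dW rW rP.
have W0 : W != finset.set0 by apply/set0Pn; exists r.
have [f [fW fmin]] := minimizers W0.
have fonto := minimizer_onto dW fW fmin.
have imf (i j : I) : i != j -> f i = f j -> f @: [set~ i] = W.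
  move=> ij fij; apply/setP => w; apply/imsetP/idP => [[l _ ->]//|wW].
  have [l <-] := fonto w wW; have [->|li] := eqVneq l i.
    by exists j => //; rewrite !inE eq_sym.
  by exists l; rewrite // !inE.
have finj (i j : I) : i != j -> f i = f j -> {in [set~ i] &, injective f}.
  move=> ij fij; apply/imset_injP; rewrite (imf _ _ ij fij).
  by apply/eqP; rewrite cardsC1 -cW.
have [i [j [ij fij]]] : exists i j, i != j /\ f i = f j.
  have /injectivePn[i [j ij fij]] : ~~ injectiveb f.
    apply/negP => /injectiveP finj'.
    have := card_imset predT finj'.
    rewrite -[RHS]/#|I| -cW => e.
    have : f @: predT \subset W by apply/subsetP => _ /imsetP[l _ ->].
    by move=> /subset_leq_card; rewrite e ltnn.
  by exists i, j.
(* The points above the lowest element of W in all rankings but l. A new point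
   that takes over as the lowest one for l has to be the highest of them for
   l. *)
pose A l := [set x : V | [forall (m | m != l), rk m (f m) < rk m x]].
have slA l : sl l \in A l.
  rewrite inE; apply/forall_inP => m ml.
  by apply: leq_ltn_trans (fmin m _ rW) _; apply: sl_max.
pose top l := [arg max_(x > sl l in A l) rk l x].
have topA l : top l \in A l by rewrite /top; case: arg_maxnP.
have topmax l x : x \in A l -> rk l x <= rk l (top l).
  by rewrite /top; case: arg_maxnP => // y _ H /H.
have AP l x m : x \in A l -> m != l -> rk m (f m) < rk m x.
  by rewrite inE => /forall_inP; apply.
have Alow l x : x \in A l -> rk l x <= rk l (f l).
  move=> xA; have /undominatedP /(_ x)[m Hm] := dW.
  move: Hm; have [->|ml Hm] := eqVneq m l; last first.
    by have := AP l x m xA ml; rewrite ltnNge Hm.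
  by apply.
have top_room (l l' : I) : l != l' -> f l = f l' -> top l \in completions W.
  move=> ll' fll'; rewrite inE; apply/andP; split.
    apply/negP; rewrite -(imf _ _ ll' fll') => /imsetP[m].
    rewrite !inE => ml tm; have := AP l (top l) m (topA l) ml.
    by rewrite tm ltnn.
  apply/undominatedP => x; have [xA|] := boolP (x \in A l).
    exists l => z; rewrite !inE => /predU1P[->|zW]; first exact: topmax.
    exact: leq_trans (Alow _ _ xA) (fmin _ _ zW).
  rewrite inE => /forall_inPn[m /= ml]; rewrite -leqNgt => xm.
  exists m => z; rewrite !inE => /predU1P[->|zW].
    by apply: leq_trans xm (ltnW (AP l _ _ (topA l) ml)).
  exact: leq_trans xm (fmin _ _ zW).
suff -> : completions W = [set top i; top j].
  rewrite cards2; case: eqP => // e; exfalso.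
  have := AP i (top i) j (topA i); rewrite eq_sym => /(_ ij).
  by rewrite ltnNge [X in rk j X]e Alow.
apply/setP => v; rewrite [in RHS]inE !finset.in_set1; apply/idP/orP; last first.
  case=> /eqP->; first exact: (top_room i j).
  by apply: (top_room j i) => //; rewrite eq_sym.
rewrite inE => /andP[vW dv].
have vW0 : v |: W != finset.set0 by apply/set0Pn; exists v; rewrite !inE eqxx.
have [g [gW gmin]] := minimizers vW0.
have gonto := minimizer_onto dv gW gmin.
have ginj : injective g.
  have e : g @: finset.setT = v |: W.
    apply/setP => w; apply/imsetP/idP => [[l _ ->]//|wW].
    by have [l <-] := gonto w wW; exists l.
  have : {in [set: I] &, injective g}.
    by apply/imset_injP; rewrite e cardsU1 vW cardsT add1n cW.
  by move=> H x y; apply: H; rewrite inE.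
have [l gl] := gonto v (setU11 _ _).
have gf m : m != l -> g m = f m.
  move=> ml; have gmW : g m \in W.
    have := gW m; rewrite !inE => /predU1P[e|//].
    by move: ml; rewrite -(inj_eq ginj) gl e eqxx.
  apply: (@rk_inj m); apply/eqP; rewrite eqn_leq (fmin m)//.
  by rewrite gmin// !inE fW orbT.
have vA : v \in A l.
  rewrite inE; apply/forall_inP => m ml.
  rewrite ltn_neqAle -(gf m ml) gmin ?setU11// andbT.
  by rewrite (inj_eq (@rk_inj m)) -gl (inj_eq ginj).
have vtop : v = top l.
  apply: (@rk_inj l); apply/eqP; rewrite eqn_leq topmax//=.
  have /undominatedP /(_ (top l))[m Hm] := dv.
  move: Hm; have [-> Hm|ml Hm] := eqVneq m l; first by apply: Hm;
    rewrite setU11.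
  have := AP l (top l) m (topA l) ml.
  by rewrite ltnNge Hm// !inE fW orbT.
have : (l == i) || (l == j).
  apply: contraT; rewrite negb_or => /andP[li lj].
  have : g i = g j by rewrite !gf// eq_sym.
  by move/ginj => e; rewrite e eqxx in ij.
by case/orP => /eqP <-; [left|right]; apply/eqP.
Qed.

(** The door made of all slack points but one. *)
Definition slacks (k : I) : {set V} := sl @: [set~ k].

Lemma slacksP k v : (v \in slacks k) = (v == sl (lab v)) && (lab v != k).
Proof.
apply/imsetP/andP => [[i]|[/eqP e vk]]; last by exists (lab v); rewrite ?inE.
by rewrite !inE => ik ->; rewrite labK eqxx.
Qed.

(** This door leads to a single room: only the ordinary point that is highest
  for
    the ranking [k] completes it. *)
Lemma completions_boundary k : #|completions (slacks k)| = 1.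
Proof.
pose v0 := [arg max_(v > r0 | v != sl (lab v)) rk k v].
have [v0P v0max] : v0 != sl (lab v0) /\
    forall v, v != sl (lab v) -> rk k v <= rk k v0.
  by rewrite /v0; case: arg_maxnP => //.
have toreal i v : v != sl (lab v) -> rk i v <= rk i (sl i) -> False.
  move=> vP; rewrite leq_eqVlt ltnNge sl_min orbF => /eqP/rk_inj e.
  by move: vP; rewrite e labK eqxx.
apply/eqP/cards1P; exists v0; apply/setP => v; rewrite [in RHS]inE inE slacksP.
apply/andP/eqP => [[vN dv]|->].
  have [vs|vr] := eqVneq v (sl (lab v)); last first.
    apply: (@rk_inj k); apply/eqP; rewrite eqn_leq v0max//=.
    have /undominatedP /(_ v0)[i Hi] := dv.
    move: Hi; have [-> Hi|ik Hi] := eqVneq i k; first by apply: Hi;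
      rewrite setU11.
    exfalso; apply: (toreal i v0 v0P); apply: Hi.
    by rewrite finset.setU1r// slacksP labK eqxx.
  move: vN; rewrite (introT eqP vs)/= negbK => /eqP vk.
  exfalso; have /undominatedP /(_ r0)[i Hi] := dv.
  apply: (toreal i r0 r0P); apply: Hi; rewrite !inE slacksP labK eqxx/=.
  by have [->|_] := eqVneq i k; rewrite ?orbT// -vk -vs eqxx.
split; first by rewrite (negbTE v0P).
apply/undominatedP => x; have [->|xr] := eqVneq x (sl (lab x)).
  by exists (lab x) => z _; exact: sl_min.
exists k => z; rewrite !inE => /predU1P[->|]; first exact: v0max.
rewrite slacksP => /andP[/eqP ez zk]; rewrite ez; apply: ltnW;
  apply: sl_max => //.
by rewrite eq_sym.
Qed.

(** A set that carries all the labels except [k]. *)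
Definition coloured (k : I) (W : {set V}) : bool := lab @: W == [set~ k].

Lemma coloured_faces_even k (Z : {set V}) : #|Z| = #|I| ->
  lab @: Z != finset.setT ->
  2 %| #|[set z in Z | coloured k (Z :\ z)]|.
Proof.
move=> cZ nT; set P := [set z in Z | _].
have [->|/set0Pn[z1]] := eqVneq P finset.set0; first by rewrite cards0.
have injP z : z \in P -> {in Z :\ z &, injective lab}.
  rewrite inE => /andP[zZ /eqP c]; apply/imset_injP; rewrite c cardsC1.
  by rewrite -cZ (cardsD1 z Z) zZ.
move=> z1P; have := z1P; rewrite inE => /andP[z1Z /eqP c1].
have l1k : lab z1 != k.
  apply: contra nT => /eqP e; apply/eqP/setP => y; rewrite inE.
  have [->|yk] := eqVneq y k; first by rewrite -e; apply: finset.imset_f.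
  have : y \in lab @: (Z :\ z1) by rewrite c1 !inE.
  by case/imsetP => w; rewrite !inE => /andP[_ wZ] ->; apply: finset.imset_f.
have : lab z1 \in lab @: (Z :\ z1) by rewrite c1 !inE.
case/imsetP => z2; rewrite !inE => /andP[z21 z2Z] l12.
suff -> : P = [set z1; z2] by rewrite cards2 eq_sym z21.
apply/setP => z; rewrite [in RHS]inE !finset.in_set1; apply/idP/orP.
  move=> zP; have [/eqP|z1z] := eqVneq z1 z; first by rewrite eq_sym; left.
  have [/eqP|z2z] := eqVneq z2 z; first by rewrite eq_sym; right.
  have : z1 = z2 by apply: (injP z zP); rewrite // !inE ?z1z ?z2z.
  by move=> e; rewrite e eqxx in z21.
case=> /eqP-> //; rewrite inE z2Z/=; apply/eqP/setP => y; rewrite -c1.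
apply/imsetP/imsetP => -[w]; rewrite !inE => /andP[wz wZ] ->.
  have [->|w1] := eqVneq w z1; first by exists z2; rewrite // !inE z21.
  by exists w; rewrite // !inE w1.
have [->|w2] := eqVneq w z2; first by exists z1; rewrite // !inE eq_sym z21.
by exists w; rewrite // !inE w2.
Qed.

(** Parity argument. For [k] fixed, count the pairs of a room and a coloured
    door of it. Each coloured door contributes two rooms, except [slacks k],
    which contributes one; so some room has an odd number of coloured doors, and
    such a room carries all the labels. *)
Lemma scarf_slack :
  exists Z : {set V}, undominated Z /\ lab @: Z = finset.setT /\ #|Z| = #|I|.
Proof.
pose room (Z : {set V}) := (#|Z| == #|I|) && undominated Z.
have [/existsP[Z /andP[/andP[/eqP cZ dZ] /eqP lZ]]|] :=
  boolP [exists Z, room Z && (lab @: Z == finset.setT)]; first by exists Z.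
rewrite negb_exists => /forallP nogood; exfalso.
pose k := lab r0.
pose P1 (p : {set V} * V) :=
  [&& room p.1, p.2 \in p.1 & coloured k (p.1 :\ p.2)].
pose P2 (p : {set V} * V) :=
  [&& #|p.1|.+1 == #|I|, coloured k p.1 & p.2 \in completions p.1].
have e12 : \sum_(p | P1 p) 1 = \sum_(p | P2 p) 1.
  rewrite (reindex_onto (fun p => (p.2 |: p.1, p.2))
                        (fun p => (p.1 :\ p.2, p.2)))/=; last first.
    by case=> Z z /and3P[/= _ zZ _]; rewrite finset.setD1K.
  apply: eq_bigl => -[W v]; rewrite /P1 /P2 /room /= setU11.
  rewrite /completions [v \in finset _]inE /=.
  have [vW|vW] := boolP (v \in W); last first.
    rewrite finset.setU1K// eqxx andbT cardsU1 vW add1n /=.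
    by case: (_ == _) => //=; rewrite andbC.
  rewrite /= !andbF; apply/negP => /andP[_ /eqP[e]].
  by move: vW; rewrite -e !inE eqxx.
have ev1 : 2 %| \sum_(p | P1 p) 1.
  rewrite (eq_bigl (fun p : {set V} * V => room p.1 &&
    ((p.2 \in p.1) && coloured k (p.1 :\ p.2))))//.
  rewrite -(pair_big_dep room (fun Z z => (z \in Z) && coloured k (Z :\ z))
    (fun _ _ => 1))/=.
  apply: dvdn_sum => Z rZ; rewrite sum1dep_card.
  have /negP nZ := nogood Z; have /andP[/eqP cZ _] := rZ.
  by apply: coloured_faces_even => //; apply/negP => H; apply: nZ; rewrite rZ.
have cI : 0 < #|I| by apply/card_gt0P; exists k.
have lk : lab @: slacks k = [set~ k].
  rewrite /slacks -imset_comp; apply/setP => y.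
  apply/imsetP/idP => [[i ik ->]|yk]; rewrite /= ?labK//.
  by exists y; rewrite //= labK.
move: ev1; rewrite e12.
rewrite (eq_bigl (fun p : {set V} * V => ((#|p.1|.+1 == #|I|) &&
   coloured k p.1) && (p.2 \in completions p.1))); last first.
  by move=> p; rewrite /P2 andbA.
rewrite -(pair_big_dep (fun W : {set V} => (#|W|.+1 == #|I|) && coloured k W)
    (fun W v => v \in completions W) (fun _ _ => 1))/=.
rewrite (bigD1 (slacks k))/=; last first.
  rewrite /coloured lk eqxx andbT /slacks card_imset; last exact: can_inj labK.
  by rewrite cardsC1 prednK.
rewrite sum1_card completions_boundary dvdn_addl //.
apply: dvdn_sum => W /andP[/andP[/eqP cW /eqP lW] Wk].
rewrite sum1_card.
have [r /andP[rW rP]|slk] := pickP [pred r | (r \in W) && (r != sl (lab r))].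
  have [dW|dW] := boolP (undominated W).
    by rewrite (completions_interior cW dW rW rP).
  suff -> : completions W = finset.set0 by rewrite cards0.
  apply/setP => v; rewrite !inE; apply/negP => /andP[_ dv].
  by move: dW; rewrite (undominatedS _ dv)// finset.subsetUr.
exfalso; move/eqP: Wk; apply; apply/setP => v; rewrite slacksP.
apply/idP/andP => [vW|[/eqP ev lv]].
  have := slk v; rewrite /= vW/= => /negbFE/eqP <-; split; first by [].
  have : lab v \in [set~ k] by rewrite -lW finset.imset_f.
  by rewrite !inE.
have : lab v \in lab @: W by rewrite lW !inE.
case/imsetP => w wW lvw.
have := slk w; rewrite /= wW/= => /negbFE/eqP ew.
by rewrite ev lvw -ew.
Qed.
End Scarf.

(** Scarf's lemma: for a labelling of a finite set with one ranking for each
    label, there is a nonempty set [C] such that no point exceeds the lowest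
    elements of [C] in all the rankings that are labels of [C]. *)
Theorem scarf (A I : finType) (rk : I -> A -> nat) (lab : A -> I) (a0 : A) :
  (forall i, injective (rk i)) ->
  exists C : {set A}, C != finset.set0 /\
    forall x, exists2 i, i \in lab @: C & forall c, c \in C -> rk i x <= rk i c.
Proof.
move=> rk_inj.
(* Slack points are added as a second copy of I; top exceeds all ranks. *)
pose top := (\max_(p : I * A) rk p.1 p.2).+2.
pose rk' i (v : A + I) := match v with
  | inl a => (rk i a).+1
  | inr j => if j == i then 0 else top + enum_rank j end.
pose lab' (v : A + I) := match v with inl a => lab a | inr j => j end.
have rk_top i a : (rk i a).+1 < top.
  by rewrite /top !ltnS (leq_bigmax (i, a)).
have rk'_inj i : injective (rk' i).
  move=> [a|j] [b|l] /=.
  - by case=> /rk_inj ->.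
  - by case: ifP => // _ e; have := rk_top i a; rewrite e; lia.
  - by case: ifP => // _ e; have := rk_top i b; rewrite -e; lia.
  - case: eqP => [->|_]; case: eqP => [->|_] // /addnI.
    by move/ord_inj/enum_rank_inj ->.
have lab'K : cancel inr lab' by [].
have mini i v : rk' i (inr i) <= rk' i v by rewrite /= eqxx.
have maxi i j v : i != j -> v != inr (lab' v) -> rk' i v < rk' i (inr j).
  case: v => [a|l] /=; last by rewrite eqxx.
  rewrite eq_sym => /negbTE -> _; have := rk_top i a; lia.
have r0P : inl a0 != inr (lab' (inl a0)) :> A + I by [].
have [Z [/undominatedP dZ [lZ cZ]]] := scarf_slack rk'_inj lab'K mini maxi r0P.
have linj : {in Z &, injective lab'} by apply/imset_injP; rewrite lZ cardsT cZ.
pose C := [set a | inl a \in Z].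
have key x : exists2 i, i \in lab @: C & forall c, c \in C -> rk i x <= rk i c.
  have [i Hi] := dZ (inl x); exists i; last first.
    by move=> c; rewrite inE => /Hi /=; rewrite ltnS.
  have : i \in lab' @: Z by rewrite lZ inE.
  case/imsetP => -[a aZ ia|j jZ ij]; first by rewrite ia;
    apply: finset.imset_f; rewrite inE.
  by have /= := Hi _ jZ; rewrite ij eqxx.
exists C; split=> //.
have [i /imsetP[c cC _] _] := key a0.
by apply/set0Pn; exists c.
Qed.

(** A discrete form of the Knaster-Kuratowski-Mazurkiewicz theorem. The grid of
    the simplex consists of the families of naturals with sum [P]. For every
    labelling of the grid there are a point [a] and a set of labels [B] such
    that [a] is small outside [B], and each label of [B] is taken at a point
    close to [a]; small and close mean less than #|I|, independently of [P]. *)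
Lemma simplex_labelling (I : finType) (i0 : I) (P : nat)
    (lab : (I -> nat) -> I) :
  exists (a : I -> nat) (B : {set I}),
    [/\ \sum_i a i = P, forall j, j \notin B -> a j < #|I| &
      forall i, i \in B -> exists a' : I -> nat,
        [/\ \sum_i a' i = P, lab a' = i &
          forall j, a j < a' j + #|I| /\ a' j < a j + #|I|]].
Proof.
pose A := {a : {ffun I -> 'I_P.+1} | \sum_i (a i : nat) == P}.
pose co (a : A) (i : I) : nat := val a i.
have mk (x : I -> nat) : \sum_i x i = P -> exists a : A, forall i, co a i = x i.
  move=> sx; have xP i : x i < P.+1 by rewrite ltnS -sx (bigD1 i)//= leq_addr.
  pose f := [ffun i => Ordinal (xP i)].
  have fP : \sum_i (f i : nat) == P.
    by apply/eqP; rewrite -[RHS]sx; apply: eq_bigr => i _; rewrite ffunE.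
  by exists (exist _ f fP) => i; rewrite /co /= ffunE.
have coP (a : A) : \sum_i co a i = P by apply/eqP; exact: (valP a).
have [a0 _] := mk (fun i => if i == i0 then P else 0)
  ltac:(by rewrite -big_mkcond big_pred1_eq).
(* Points are ranked by their i-th coordinate, ties being broken arbitrarily. *)
pose rk i (a : A) := co a i * #|{: A}| + enum_rank a.
have rkle i a b : rk i a <= rk i b -> co a i <= co b i.
  rewrite /rk leqNgt => H; rewrite leqNgt; apply/negP => ab; case/negP: H.
  apply: (@leq_trans ((co b i).+1 * #|{: A}|)).
    by rewrite mulSn addnC ltn_add2r ltn_ord.
  by apply: leq_trans (leq_addr _ _); rewrite leq_mul2r ab orbT.
have rk_inj i : injective (rk i).
  move=> a b e; apply: enum_rank_inj; apply/val_inj.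
  have ab : co a i = co b i by apply/eqP; rewrite eqn_leq !rkle ?e.
  by move: e; rewrite /rk ab => /addnI.
have [C [/set0Pn[c0 c0C] domC]] := scarf (fun a => lab (co a)) a0 rk_inj.
pose B := [set lab (co a) | a in C].
pose mu i := co [arg min_(c < c0 in C) co c i] i.
have muC i : exists2 c, c \in C & co c i = mu i.
  by rewrite /mu; case: arg_minnP => // c cC _; exists c.
have mule i c : c \in C -> mu i <= co c i.
  by rewrite /mu; case: arg_minnP => // c' _ H /H.
(* Otherwise the point with coordinates mu i + 1 on B, one of them increased to
   reach the sum P, would exceed the lowest elements of C in all the rankings
   of B. *)
have mubig : P < \sum_(i in B) (mu i).+1.
  rewrite ltnNge; apply/negP => le.
  have [i1 i1B _] := domC a0.
  have [|x xE] := mk (fun i => (if i \in B then (mu i).+1 else 0) +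
    (if i == i1 then P - \sum_(i in B) (mu i).+1 else 0)).
    by rewrite big_split/= -!big_mkcond/= big_pred1_eq subnKC.
  have [i iB Hi] := domC x; have [c cC ci] := muC i.
  by have := rkle _ _ _ (Hi c cC); rewrite xE iB ci; lia.
have cB (c : A) : c \in C -> P < \sum_(i in B) co c i + #|B|.
  move=> cC; apply: leq_trans mubig _.
  rewrite -sum1_card -big_split/=; apply: leq_sum => i _.
  by rewrite addn1 ltnS mule.
have leB : #|B| <= #|I| := max_card _.
have outB (c : A) j : c \in C -> j \notin B -> co c j < #|I|.
  move=> cC jB; have sB : \sum_(i in B) co c i + co c j <= P.
    rewrite -[leqRHS](coP c) [leqRHS](bigID (mem B))/= leq_add2l.
    by rewrite (bigD1 j jB)/= leq_addr.
  by have := cB c cC; lia.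
have diam (c c' : A) j : c \in C -> c' \in C -> co c j < co c' j + #|I|.
  move=> cC c'C; have [jB|jB] := boolP (j \in B); last first.
    exact: ltn_addl (outB c j cC jB).
  have : co c j < mu j + #|I|.
    pose s1 := \sum_(i in B | i != j) co c i.
    pose s2 := \sum_(i in B | i != j) (mu i).+1.
    have le1 : co c j + s1 <= P.
      rewrite -[leqRHS](coP c) [leqRHS](bigID (mem B))/=.
      by rewrite [X in _ <= X + _](bigD1 j jB)/= leq_addr.
    have le2 : P < (mu j).+1 + s2 by move: mubig; rewrite (bigD1 j jB).
    have le3 : s2 <= s1 + #|B|.-1.
      rewrite (cardsD1 j B) jB add1n /= -sum1_card.
      rewrite [X in _ + X](eq_bigl (fun i => (i \in B) && (i != j)));
        last first.
        by move=> i; rewrite !inE andbC.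
      by rewrite -big_split/=; apply: leq_sum => i _; rewrite addn1 ltnS mule.
    have le4 : 0 < #|B| by apply/card_gt0P; exists j.
    by lia.
  by have := mule j c' c'C; lia.
exists (co c0), B; split=> [//|j jB|i /imsetP[c cC ->]]; first exact: outB.
by exists (co c); split=> // j; split; apply: diam.
Qed.

End ScarfLemma.

Local Open Scope ring_scope.

(** * Helly's selection theorem *)

Definition infinitely_many (N : nat -> Prop) : Prop :=
  forall n, exists2 m, (n < m)%N & N m.

Lemma infinite_pigeonhole (N : nat -> Prop) (c : nat -> nat) (b : nat) :
  infinitely_many N -> (forall n, (c n < b)%N) ->
  exists v, infinitely_many (fun n => N n /\ c n = v).
Proof.
move=> infN cb; apply: contrapT => /forallNP H.
have /choice[M HM] : forall v, exists n, forall m, (n < m)%N -> N m -> c m <> v.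
  move=> v; apply: contrapT => /forallNP Hv; apply: (H v) => n.
  have /existsNP[m /not_implyP[nm /not_implyP[Nm /contrapT cm]]] := Hv n.
  by exists m.
have [m nm Nm] := infN (\max_(v < b) M v)%N.
apply: (HM (c m) m _ Nm erefl); apply: leq_ltn_trans nm.
exact: (@leq_bigmax _ (fun v : 'I_b => M v) (Ordinal (cb m))).
Qed.

(** Diagonal argument for countably many colourings of the naturals, each with
    finitely many colours. *)
Lemma diagonal_constant (c : nat -> nat -> nat) (b : nat -> nat) :
  (forall k n, (c k n < b k)%N) ->
  exists2 phi : nat -> nat, increasing_seq phi &
    forall k i, (k <= i)%N -> c k (phi i) = c k (phi k).
Proof.
move=> cb.
pose T := {N : nat -> Prop | infinitely_many N}.
have step (N : T) k : exists N' : T,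
    (forall n, sval N' n -> sval N n) /\
    exists v, forall n, sval N' n -> c k n = v.
  case: N => N infN; have [v Hv] := infinite_pigeonhole infN (cb k).
  exists (exist _ _ Hv) => /=; split; first by move=> n [].
  by exists v => n [].
have inf0 : infinitely_many (fun=> True) by move=> n; exists n.+1.
pose st N k := sval (cid (step N k)).
pose Ns := fix Ns k := if k is k'.+1 then st (Ns k') k' else exist _ _ inf0.
have NsS k n : sval (Ns k.+1) n -> sval (Ns k) n.
  by have [H _] := svalP (cid (step (Ns k) k)); exact: H.
have NsC k : exists v, forall n, sval (Ns k.+1) n -> c k n = v.
  by have [_ H] := svalP (cid (step (Ns k) k)); exact: H.
have NsL k l n : (k <= l)%N -> sval (Ns l) n -> sval (Ns k) n.
  elim: l => [|l IH]; first by rewrite leqn0 => /eqP->.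
  rewrite leq_eqVlt => /predU1P[->//|]; rewrite ltnS => kl /NsS; exact: IH.
pose pick (N : T) n := sval (cid2 (svalP N n)).
have pickgt N n : (n < pick N n)%N by rewrite /pick; case: cid2.
have pickP N n : sval N (pick N n) by rewrite /pick; case: cid2.
pose phi := fix phi k := if k is k'.+1 then pick (Ns k.+1) (phi k')
                         else pick (Ns 1%N) 0%N.
have phiP k : sval (Ns k.+1) (phi k) by case: k => [|k]; exact: pickP.
exists phi; first by apply/increasing_seqP => n; exact: pickgt.
move=> k i ki; have [v Hv] := NsC k.
by rewrite !Hv//; apply: NsL (phiP i).
Qed.

Lemma increasing_seq_cvg (phi : nat -> nat) : increasing_seq phi ->
  phi @ \oo --> \oo.
Proof.
move=> phii A [N _ NA]; exists N => // n /= Nn; apply: NA => /=.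
apply: leq_trans Nn _; elim: n => // n IH.
apply: leq_ltn_trans IH _.
by have /increasing_seqP/(_ n) := phii.
Qed.

Lemma increasing_seq_comp (phi psi : nat -> nat) :
  increasing_seq phi -> increasing_seq psi -> increasing_seq (phi \o psi).
Proof. by move=> ip iq m n; exact: etrans (ip _ _) (iq _ _). Qed.

Section RealSequences.
Context {R : realType}.
Implicit Types (f g m : R -> R).

(** Countably many sequences in [0, 1] converge along a common subsequence. *)
Lemma countable_select (a : nat -> nat -> R) :
  (forall j n, 0 <= a j n <= 1) ->
  exists2 phi : nat -> nat, increasing_seq phi &
    forall j, cvgn (a j \o phi).
Proof.
move=> a01.
(* The colouring with code (j, l) locates the terms of the j-th sequence with
   precision 1 / (l + 1). *)
pose c k n := if @unpickle (nat * nat)%type k is Some jl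
  then Num.trunc (a jl.1 n * jl.2.+1%:R) else 0%N.
pose b k := if @unpickle (nat * nat)%type k is Some jl
  then jl.2.+2 else 1%N.
have cb k n : (c k n < b k)%N.
  rewrite /c /b; case: unpickle => // -[j l] /=.
  have /andP[a0 a1] := a01 j n.
  rewrite truncn_lt_nat ?mulr_ge0// (@le_lt_trans _ _ l.+1%:R) ?ltr_nat//.
  by rewrite ler_piMl.
have [phi phii Hphi] := diagonal_constant cb.
exists phi => // j; apply/cauchy_cvgP/cauchy_exP => e e0.
have [l le] : exists l : nat, l.+1%:R^-1 < e.
  exists (Num.trunc e^-1); rewrite invf_plt ?posrE//.
  exact: truncnS_gt.
pose k := pickle (j, l); exists (a j (phi k)).
exists k => // i /= ki.
have := Hphi k i ki; rewrite /c /k pickleK/= -/k => E.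
have [/andP[a0 a1] /andP[b0 b1]] := (a01 j (phi k), a01 j (phi i)).
have la : 0 <= a j (phi k) * l.+1%:R by rewrite mulr_ge0.
have lb : 0 <= a j (phi i) * l.+1%:R by rewrite mulr_ge0.
have /andP[Ha Ha'] := truncn_itv la; have /andP[Hb Hb'] := truncn_itv lb.
rewrite E in Hb Hb'.
rewrite /ball/=; apply: le_lt_trans le.
rewrite -[leRHS]mul1r ler_pdivlMr ?ltr0n// -[X in _ * X]ger0_norm//.
rewrite -normrM mulrBl ler_norml.
move: Ha Ha' Hb Hb'; rewrite -[(Num.trunc _).+1%:R]natr1.
set x := _ * _; set y := a j (phi i) * _; set z := _%:R.
by move=> *; apply/andP; split; lra.
Qed.

Definition nondec m : Prop := {homo m : x y / x <= y}.

(** For nondecreasing [g], the points where the left and right limits of [g]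
    differ. *)
Definition jump g (s : R) : Prop :=
  exists2 e, 0 < e & forall d, 0 < d -> g (s - d) + e <= g (s + d).

Lemma jump_countable g : nondec g -> countable [set s | jump g s].
Proof.
move=> mg.
have /choice[q qP] : forall s, exists q : rat, jump g s ->
    forall t, (t < s -> g t < ratr q) /\ (s < t -> ratr q < g t).
  move=> s; have [[e e0 js]|nj] := pselect (jump g s); last by exists 0.
  pose A := g @` [set t | t < s].
  have gap t t' : t < s -> s < t' -> g t + e <= g t'.
    move=> ts st'; pose d := Num.min (s - t) (t' - s).
    have d0 : 0 < d by rewrite /d lt_min !subr_gt0 ts.
    have d1 : d <= s - t by rewrite /d ge_min lexx.
    have d2 : d <= t' - s by rewrite /d ge_min lexx orbT.
    have h1 : g t <= g (s - d) by apply: mg; lra.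
    have h2 : g (s + d) <= g t' by apply: mg; lra.
    have := js d d0; lra.
  have supA : has_sup A.
    split; first by exists (g (s - 1)); exists (s - 1) => //=; lra.
    exists (g (s + 1)) => _ [t /= ts <-]; apply: mg; lra.
  have [q] : exists q : rat, ratr q \in `]sup A, (sup A + e)[.
    by apply: rat_in_itvoo; rewrite ltrDl.
  rewrite in_itv/= => /andP[q1 q2]; exists q => _ t; split=> [ts|st].
    apply: le_lt_trans q1; apply: sup_upper_bound => //; by exists t.
  apply: lt_le_trans q2 _; rewrite -lerBrDr; apply: sup_le_ub => //.
    by case: supA.
  by move=> _ [t' /= t's <-]; rewrite lerBrDr; exact: gap.
apply/countable_injP; exists (pickle \o q) => s t.
rewrite !inE /= => js jt /(pcan_inj pickleK) qst.
have lt_q s' t' : jump g s' -> jump g t' -> s' < t' ->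
  ratr (q s') < ratr (q t') :> R.
  move=> js' jt' st'; pose x := (s' + t') / 2.
  have [_ h1] := qP s' js' x; have [h2 _] := qP t' jt' x.
  by apply: lt_trans (h1 _) (h2 _); rewrite /x; lra.
have [st|ts|//] := ltgtP s t.
  by have := lt_q _ _ js jt st; rewrite qst ltxx.
by have := lt_q _ _ jt js ts; rewrite qst ltxx.
Qed.

(** Sequences squeezed between shifts of [g] converge to [g] off its jumps. *)
Lemma cvg_off_jump (f : nat -> R -> R) g (a b s : R) : nondec g ->
  (forall t t' e, a <= t -> t < t' -> t' <= b -> 0 < e ->
     \forall n \near \oo, f n t <= g t' + e /\ g t <= f n t' + e) ->
  a < s < b -> ~ jump g s -> f n s @[n --> \oo] --> g s.
Proof.
move=> mg H /andP[as_ sb] nj; apply/cvgrPdist_le => e e0.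
have [d d0 gd] : exists2 d, 0 < d & g (s + d) < g (s - d) + e / 2.
  apply: contrapT => nd; apply: nj; exists (e / 2); first lra.
  move=> d d0; rewrite leNgt; apply/negP => gd; apply: nd; by exists d.
pose d' := Num.min d (Num.min (s - a) (b - s)).
have d'0 : 0 < d' by rewrite /d' !lt_min d0 !subr_gt0 as_.
have d'd : d' <= d by rewrite /d' ge_min lexx.
have d'a : d' <= s - a by rewrite /d' !ge_min lexx orbT.
have d'b : d' <= b - s by rewrite /d' !ge_min lexx !orbT.
have g1 : g (s - d) <= g (s - d') by apply: mg; lra.
have g2 : g (s + d') <= g (s + d) by apply: mg; lra.
have g3 : g (s - d') <= g s by apply: mg; lra.
have g4 : g s <= g (s + d') by apply: mg; lra.
have e20 : 0 < e / 2 by lra.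
have h1 := H (s - d') s (e / 2) ltac:(lra) ltac:(lra) ltac:(lra) e20.
have h2 := H s (s + d') (e / 2) ltac:(lra) ltac:(lra) ltac:(lra) e20.
near=> n.
have [_ k1] : f n (s - d') <= g s + e / 2 /\ g (s - d') <= f n s + e / 2.
  by near: n.
have [k2 _] : f n s <= g (s + d') + e / 2 /\ g s <= f n (s + d') + e / 2.
  by near: n.
by rewrite ler_norml; apply/andP; split; lra.
Unshelve. all: by end_near. Qed.

(** Helly's selection theorem, with convergence at every point. *)
Lemma helly (f : nat -> R -> R) : (forall n, nondec (f n)) ->
  (forall n s, 0 <= f n s <= 1) ->
  exists2 phi : nat -> nat, increasing_seq phi &
    forall s, cvgn (fun n => f (phi n) s).
Proof.
move=> mf f01.
pose rat_of n : R := ratr (odflt 0 (@unpickle rat n)).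
have [phi phii phic] := countable_select (fun j n => f01 n (rat_of j)).
have phiq : forall q : rat, cvgn (fun n => f (phi n) (ratr q)).
  by move=> q; have := phic (pickle q); rewrite /comp /rat_of pickleK.
pose L (q : rat) : R := limn (fun n => f (phi n) (ratr q)).
have L01 q : 0 <= L q <= 1.
  apply/andP; split; [apply: limr_ge => //|apply: limr_le => //];
  by apply: nearW => n; have /andP[] := f01 (phi n) (ratr q).
have Lmono q r : (q <= r)%R -> L q <= L r.
  move=> qr; apply: ler_lim => //; apply: nearW => n; apply: mf.
  by rewrite ler_rat.
pose U (s : R) : set R := [set L q | q in [set q : rat | s < ratr q]].
(* The limit off the jumps of g; at the jumps themselves a further subsequence
   has to be extracted, and the limit may differ from g. *)
pose g (s : R) : R := inf (U s).
have U_inf s : has_inf (U s).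
  split; last by exists 0 => _ [q _ <-]; have /andP[] := L01 q.
  have [q] : exists q : rat, ratr q \in `]s, (s + 1)[.
    by apply: rat_in_itvoo; rewrite ltrDl.
  by rewrite in_itv/= => /andP[sq _]; exists (L q); exists q.
have gle s q : s < ratr q -> g s <= L q.
  by move=> sq; apply: inf_lbound; [case: (U_inf s)|exists q].
have gge s q : ratr q <= s -> L q <= g s.
  move=> qs; apply: lb_le_inf; first by case: (U_inf s).
  move=> _ [r /= sr <-]; apply: Lmono; rewrite -(ler_rat R); lra.
have mg : nondec g.
  move=> s t st; apply: lb_le_inf; first by case: (U_inf t).
  move=> _ [r /= tr <-]; apply: gle; exact: le_lt_trans tr.
have Lcvg q e : 0 < e -> \forall n \near \oo, `|L q - f (phi n) (ratr q)| <= e.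
  move=> e0; have : (fun n => f (phi n) (ratr q)) @ \oo --> L q by exact: phiq.
  by move/cvgrPdist_le; apply.
have phig s : ~ jump g s -> f (phi n) s @[n --> \oo] --> g s.
  apply: (@cvg_off_jump (f \o phi) g (s - 1) (s + 1)) => //; last lra.
  move=> t t' e _ tt' _ e0; have [q] := rat_in_itvoo tt'.
  rewrite in_itv/= => /andP[tq qt'].
  near=> n.
  have : `|L q - f (phi n) (ratr q)| <= e by near: n; exact: Lcvg.
  rewrite ler_norml => /andP[h1 h2] /=.
  have h3 : f (phi n) t <= f (phi n) (ratr q) by apply: mf; exact: ltW.
  have h4 : f (phi n) (ratr q) <= f (phi n) t' by apply: mf; exact: ltW.
  have h5 := gge _ _ (ltW qt'); have h6 := gle _ _ tq.
  by split; lra.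
have [j jsurj] : exists j : nat -> R, forall s, jump g s -> exists n, j n = s.
  have /pcard_surjP[j js] := jump_countable mg.
  by exists j => s /js[n _ <-]; exists n.
have [psi psii psic] := countable_select (fun k n => f01 (phi n) (j k)).
exists (phi \o psi); first exact: increasing_seq_comp.
move=> s; have [/jsurj[k <-]|nj] := pselect (jump g s); first exact: psic.
apply/cvg_ex; exists (g s).
by apply: (cvg_comp _ _ (increasing_seq_cvg psii) (phig s nj)).
Unshelve. all: by end_near. Qed.

End RealSequences.

(** * Levy closeness and mixing of nondecreasing functions *)

Section LevyCloseness.
Context {R : realType}.
Implicit Types (f g m : R -> R) (eta : R).

(** On [0, 1], the functions differ by at most [eta] after a shift of at most
    [eta] in the argument; no constraint is imposed where the shifted argument
    leaves [0, 1]. *)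
Definition close eta m m' : Prop :=
  forall s t, 0 <= s -> s + eta <= t -> t <= 1 ->
    m s <= m' t + eta /\ m' s <= m t + eta.

Lemma close_sym eta m m' : close eta m m' -> close eta m' m.
Proof. by move=> H s t s0 st t1; have [] := H s t s0 st t1. Qed.

Lemma close_le eta eta' m m' : eta <= eta' -> close eta m m' -> close eta' m m'.
Proof.
by move=> le H s t s0 st t1; have [h1 h2] := H s t s0 ltac:(lra) t1; split; lra.
Qed.

Lemma close_trans eta eta' m m' m'' : 0 <= eta -> 0 <= eta' ->
  close eta m m' -> close eta' m' m'' -> close (eta + eta') m m''.
Proof.
move=> e0 e'0 H H' s t s0 st t1; split.
  have [h1 _] := H s (s + eta) s0 ltac:(lra) ltac:(lra).
  by have [h2 _] := H' (s + eta) t ltac:(lra) ltac:(lra) t1; lra.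
have [_ h1] := H' s (s + eta') s0 ltac:(lra) ltac:(lra).
by have [_ h2] := H (s + eta') t ltac:(lra) ltac:(lra) t1; lra.
Qed.

Lemma close_refl eta m : 0 <= eta -> nondec m -> close eta m m.
Proof.
move=> e0 mm s t _ st _; have : m s <= m t by apply: mm; lra.
by move=> h; split; lra.
Qed.

Lemma close_on_grid (N : nat) eta m m' : (0 < N)%N -> N%:R^-1 <= eta ->
  nondec m -> nondec m' ->
  (forall k : 'I_N.+1, `|m (k%:R / N%:R) - m' (k%:R / N%:R)| <= eta) ->
  close eta m m'.
Proof.
move=> N0 Ne mm mm' H s t s0 st t1.
have N0' : 0 < N%:R :> R by rewrite ltr0n.
have sN : 0 <= s * N%:R by rewrite mulr_ge0.
have /andP[k1 k2] := truncn_itv sN.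
set k := (Num.trunc (s * N%:R)).+1 in k2.
have sk : s <= k%:R / N%:R by rewrite ler_pdivlMr// ltW.
have kt : k%:R / N%:R <= t.
  apply: le_trans st; apply: (@le_trans _ _ (s + N%:R^-1)); last lra.
  rewrite ler_pdivrMr// mulrDl mulVf ?gt_eqF// /k -natr1; lra.
have kN : (k < N.+1)%N.
  by rewrite ltnS -(ler_nat R) -[leRHS]mul1r -ler_pdivrMr// (le_trans kt).
have := H (Ordinal kN); rewrite /= ler_norml => /andP[h1 h2].
have h3 := mm _ _ sk; have h4 := mm _ _ kt.
have h5 := mm' _ _ sk; have h6 := mm' _ _ kt.
by split; lra.
Qed.

Lemma cvg_close (f : nat -> R -> R) g eta : (forall n, nondec (f n)) ->
  nondec g -> 0 < eta -> (forall s, f n s @[n --> \oo] --> g s) ->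
  \forall n \near \oo, close eta (f n) g.
Proof.
move=> mf mg e0 fg.
pose N := (Num.trunc eta^-1).+1.
have Ne : N%:R^-1 <= eta.
  by rewrite invf_ple ?posrE ?ltr0n// ltW// truncnS_gt.
have : \forall n \near \oo, forall k : 'I_N.+1,
    `|f n (k%:R / N%:R) - g (k%:R / N%:R)| <= eta.
  apply: filter_forall => k; have /cvgrPdist_le/(_ eta e0) := fg (k%:R / N%:R).
  by apply: filterS => n; rewrite distrC.
by apply: filterS => n; apply: close_on_grid.
Qed.

Lemma close_cvg (f : nat -> R -> R) g s : nondec g ->
  (forall eta, 0 < eta -> \forall n \near \oo, close eta (f n) g) ->
  0 < s < 1 -> ~ jump g s -> f n s @[n --> \oo] --> g s.
Proof.
move=> mg H s01 nj; apply: (@cvg_off_jump R f g 0 1) => // t t' e t0 tt' t'1 e0.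
pose eta := Num.min e (t' - t).
have eta0 : 0 < eta by rewrite /eta lt_min e0 subr_gt0.
have eta1 : eta <= e by rewrite /eta ge_min lexx.
have eta2 : eta <= t' - t by rewrite /eta ge_min lexx orbT.
apply: filterS (H eta eta0) => n /(_ t t' t0 _ t'1) []; first lra.
by move=> h1 h2; split; lra.
Qed.

(** [m] is the maximum of the [g j] over the indices whose threshold has been
    passed. The set of these indices grows with the argument, so that [m] is
    nondecreasing when the [g j] are. *)
Definition is_mix (I : finType) (th : I -> R) (g : I -> R -> R) m : Prop :=
  forall s, 0 <= s ->
    (exists2 j, th j <= s & m s = g j s) /\
    (forall j, th j <= s -> g j s <= m s).

Lemma mix_exists (I : finType) (th : I -> R) (g : I -> R -> R) (K : set R) :
  (exists j, th j <= 0) -> (forall j, nondec (g j)) ->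
  (forall j s, K (g j s)) ->
  exists m, [/\ nondec m, forall s, K (m s) & is_mix th g m].
Proof.
move=> [j0 j0P] mg Kg.
have p0 (s : R) : 0 <= Num.max 0 s by rewrite le_max lexx.
pose J s := [arg max_(j > j0 | th j <= Num.max 0 s) g j (Num.max 0 s)]%O.
have JP s : th (J s) <= Num.max 0 s /\
    forall j, th j <= Num.max 0 s -> g j (Num.max 0 s) <= g (J s) (Num.max 0 s).
  by rewrite /J; case: arg_maxP => [|j h1 h2]; [exact: le_trans j0P _|].
exists (fun s => g (J s) (Num.max 0 s)); split=> //.
  move=> s t st; have st' : Num.max 0 s <= Num.max 0 t by rewrite le_max2 ?lexx.
  apply: (@le_trans _ _ (g (J s) (Num.max 0 t))); first exact: mg.
  have [js _] := JP s; have [_ jt] := JP t; apply: jt.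
  exact: le_trans js st'.
move=> s s0; have [h1 h2] := JP s.
rewrite (max_idPr s0) in h1 h2 *; split=> //; by exists (J s).
Qed.

(** The mix depends continuously on the thresholds and on the functions, with a
    modulus that does not depend on their number. Indices with both
    thresholds above [1 - eta] do not matter. *)
Lemma mix_close (I : finType) (th th' : I -> R) (g g' : I -> R -> R) m m' eta :
  0 <= eta -> is_mix th g m -> is_mix th' g' m' ->
  (forall j, (1 - eta < th j /\ 1 - eta < th' j) \/
     (`|th j - th' j| <= eta /\ close eta (g j) (g' j))) ->
  close eta m m'.
Proof.
move=> e0 mix mix' H s t s0 st t1.
have t0 : 0 <= t by lra.
have [[j js mj] _] := mix s s0; have [[j' js' mj'] _] := mix' s s0.
have [_ maxt] := mix t t0; have [_ maxt'] := mix' t t0.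
split.
  have [[h1 _]|[]] := H j; first by lra.
  rewrite ler_norml => /andP[h1 h2] /(_ s t s0 st t1)[h3 _].
  have := maxt' j ltac:(lra); lra.
have [[_ h1]|[]] := H j'; first by lra.
rewrite ler_norml => /andP[h1 h2] /(_ s t s0 st t1)[_ h3].
have := maxt j' ltac:(lra); lra.
Qed.

(** The values at the multiples of 1 / N, rounded down to such multiples. These
    codes form a finite type, and functions with the same code are close. *)
Definition grid_code (N : nat) m : {ffun 'I_N.+1 -> 'I_N.+1} :=
  [ffun k : 'I_N.+1 => inord (Num.trunc (m (k%:R / N%:R) * N%:R))].

Lemma grid_code_close (N : nat) m m' : (0 < N)%N -> nondec m -> nondec m' ->
  (forall s, 0 <= m s <= 1) -> (forall s, 0 <= m' s <= 1) ->
  grid_code N m = grid_code N m' -> close N%:R^-1 m m'.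
Proof.
move=> N0 mm mm' m01 m'01 E; apply: (close_on_grid N0) => // k.
have N0' : 0 < N%:R :> R by rewrite ltr0n.
have tr m1 : (forall s, 0 <= m1 s <= 1) -> forall s,
   (Num.trunc (m1 s * N%:R) < N.+1)%N /\
   (Num.trunc (m1 s * N%:R))%:R <= m1 s * N%:R < (Num.trunc (m1 s * N%:R))%:R
     + 1.
  move=> H s; have /andP[h0 h1] := H s.
  have hN : 0 <= m1 s * N%:R by rewrite mulr_ge0.
  split; last by rewrite natr1 truncn_itv.
  rewrite truncn_lt_nat// -natr1; apply: (@le_lt_trans _ _ N%:R); last lra.
  by rewrite ler_piMl// ltW.
have := congr1 (fun h : {ffun 'I_N.+1 -> 'I_N.+1} => val (h k)) E.
rewrite !ffunE /=; have [t1 /andP[i1 i1']] := tr m m01 (k%:R / N%:R).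
have [t2 /andP[i2 i2']] := tr m' m'01 (k%:R / N%:R).
rewrite !inordK// => e; rewrite e in i1 i1'.
rewrite -[leRHS]mul1r ler_pdivlMr// -{3}(ger0_norm (ltW N0')).
rewrite -normrM mulrBl ler_norml.
move: i1 i1' i2 i2'; set x := m _ * _; set y := m' _ * _; set z := _%:R.
by move=> *; apply/andP; split; lra.
Qed.

Section ApproximateFixedPoint.
Variables (D : set (R -> R)) (G : (R -> R) -> set (R -> R)).
Hypothesis D_nondec : forall m, D m -> nondec m.
Hypothesis D_01 : forall m, D m -> forall s, 0 <= m s <= 1.
Hypothesis D_mix : forall (I : finType) (th : I -> R) (g : I -> R -> R),
  (exists j, th j <= 0) -> (forall j, D (g j)) ->
    exists2 m, D m & is_mix th g m.
Hypothesis G_nonempty : forall m, D m -> exists g, G m g.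
Hypothesis G_sub : forall m g, D m -> G m g -> D g.

(** There is a mix [m] of elements [g j] of [G (c j)] in which every index that
    matters has [c j] close to [m]. *)
Lemma approximate_fixed_point (m0 : R -> R) (N : nat) : D m0 -> (0 < N)%N ->
  exists m, D m /\ exists (I : finType) (th : I -> R) (g c : I -> R -> R),
    [/\ is_mix th g m, exists j, th j <= 0, forall j, D (c j) /\ G (c j) (g j) &
      forall j, 1 - N%:R^-1 < th j \/ close (N%:R^-1 + N%:R^-1) (c j) m].
Proof.
move=> Dm0 N0; pose I := {ffun 'I_N.+1 -> 'I_N.+1} : finType.
have N0' : 0 < N%:R^-1 :> R by rewrite invr_gt0 ltr0n.
have /choice[c cP] : forall i : I, exists c, D c /\
    (forall m, D m -> grid_code N m = i -> close N%:R^-1 c m).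
  move=> i; have [[c [Dc ci]]|nc] :=
    pselect (exists c, D c /\ grid_code N c = i).
    exists c; split=> // m Dm mi; apply: grid_code_close => //; try exact: D_01.
    - exact: D_nondec.
    - exact: D_nondec.
    - by rewrite ci mi.
  by exists m0; split=> // m Dm mi; exfalso; apply: nc; exists m.
have /choice[g gP] : forall i, exists g, G (c i) g.
  by move=> i; apply: G_nonempty; have [] := cP i.
have Dg i : D (g i) by apply: G_sub (gP i); have [] := cP i.
pose n := #|I|.
have n0 : (0 < n)%N by apply/card_gt0P; exists (grid_code N m0).
(* With this choice grid points at distance less than n have thresholds at
   distance at most 1 / N. *)
pose P := (n ^ 2 * N)%N.
have P0 : (0 < P)%N by rewrite muln_gt0 expn_gt0 n0.
have P0' : 0 < P%:R :> R by rewrite ltr0n.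
(* A zero weight gives the threshold 1; the largest weight is at least P / n,
   and gives the threshold 0. *)
pose th (a : I -> nat) j : R := Num.max 0 (1 - (n * a j)%:R / P%:R).
have thP a : (\sum_i a i)%N = P -> exists j, th a j <= 0.
  move=> sa; suff [j jP] : exists j, (P <= n * a j)%N.
    exists j; rewrite /th ge_max lexx/= subr_le0 ler_pdivlMr// mul1r.
    by rewrite ler_nat.
  apply: contrapT => /forallNP H.
  have : (\sum_(i : I) n * a i <= \sum_(i : I) P.-1)%N.
    apply: leq_sum => i _; have /negP := H i; rewrite -ltnNge => h.
    by rewrite -ltnS prednK.
  rewrite -big_distrr/= sa sum_nat_const -/n leq_pmul2l//.
  by rewrite -ltnS prednK// ltnn.
(* A grid point is labelled by the code of the corresponding mix. *)
have /choice[q qP] : forall a : I -> nat, exists q, (\sum_i a i)%N = P ->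
    D q /\ is_mix (th a) g q.
  move=> a; have [sa|] := pselect ((\sum_i a i)%N = P); last by exists m0.
  by have [q Dq mq] := D_mix (thP a sa) Dg; exists q.
have [a [B [sa outB inB]]] :=
  simplex_labelling (grid_code N m0) P (fun a => grid_code N (q a)).
have [Dq mq] := qP a sa.
exists (q a); split=> //; exists I, (th a), g, c; split=> //.
- exact: thP.
- by move=> j; split=> //; have [] := cP j.
have PE : P%:R = n%:R * n%:R * N%:R :> R by rewrite /P natrM natrX expr2.
have n0' : 0 < n%:R :> R by rewrite ltr0n.
have small x : (x < n)%N -> (n * x)%:R / P%:R < N%:R^-1 :> R.
  move=> xn; rewrite ltr_pdivrMr// PE [ltRHS]mulrC mulfK ?pnatr_eq0 -?lt0n//.
  by rewrite -natrM ltr_nat ltn_pmul2l.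
move=> j; have [jB|jB] := boolP (j \in B); [right|left]; last first.
  rewrite /th lt_max; apply/orP; right.
  by have := small _ (outB j jB); lra.
have [a' [sa' la' diff]] := inB j jB.
have [Dq' mq'] := qP a' sa'.
apply: (@close_trans _ _ _ (q a')); try exact: ltW.
  by have [_] := cP j; apply.
apply: (mix_close _ mq' mq); first exact: ltW.
move=> i; right; split; last by apply: close_refl; [exact: ltW|exact: D_nondec].
have [d1 d2] := diff i.
have lip (x y : R) : `|Num.max 0 x - Num.max 0 y| <= `|x - y|.
  have := ler_norm (x - y); have := ler_norm (y - x); rewrite distrC ler_norml.
  move: `|_| => z h1 h2.
  by have [x0|x0] := leP 0 x; have [y0|y0] := leP 0 y; apply/andP; split; lra.
apply: le_trans (lip _ _) _; rewrite opprB addrC addrA subrK -mulrBl.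
have sm x y : (x < y + n)%N -> ((n * x)%:R - (n * y)%:R) / P%:R <= N%:R^-1 :> R.
  move=> xy; have [xley|yx] := leqP x y.
    apply: (@le_trans _ _ 0); last exact: ltW.
    rewrite pmulr_lle0 ?invr_gt0// subr_le0 ler_nat; exact: leq_mul.
  rewrite -natrB ?leq_mul// 1?ltnW// -mulnBr; apply/ltW/small; lia.
rewrite ler_norml; have h1 := sm _ _ d1; have h2 := sm _ _ d2.
by move: h1 h2; rewrite !mulrBl; lra.
Qed.
End ApproximateFixedPoint.
End LevyCloseness.

(** * The fixed point theorem for nondecreasing functions *)

Section FixedPoint.
Context {R : realType}.

Definition cvg_off_jumps (f : nat -> R -> R) (m : R -> R) : Prop :=
  forall s, 0 < s < 1 -> ~ jump m s -> f n s @[n --> \oo] --> m s.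

Variables (D : set (R -> R)) (G : (R -> R) -> set (R -> R)).
Hypothesis D_nondec : forall m, D m -> nondec m.
Hypothesis D_01 : forall m, D m -> forall s, 0 <= m s <= 1.
Hypothesis D_mix : forall (I : finType) (th : I -> R) (g : I -> R -> R),
  (exists j, th j <= 0) -> (forall j, D (g j)) ->
    exists2 m, D m & is_mix th g m.
Hypothesis G_mix : forall m, D m ->
  forall (I : finType) (th : I -> R) (g : I -> R -> R),
  (exists j, th j <= 0) -> (forall j, G m (g j)) ->
  exists2 q, G m q & is_mix th g q.
Hypothesis G_nonempty : forall m, D m -> exists g, G m g.
Hypothesis G_sub : forall m g, D m -> G m g -> D g.
Hypothesis D_closed : forall (f : nat -> R -> R) m, (forall n, D (f n)) ->
  (forall s, f n s @[n --> \oo] --> m s) -> D m.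
Hypothesis G_closed : forall (f g : nat -> R -> R) m m',
  (forall n, D (f n) /\ G (f n) (g n)) -> D m -> D m' ->
  cvg_off_jumps f m -> cvg_off_jumps g m' -> G m m'.

Lemma D_select (f : nat -> R -> R) : (forall n, D (f n)) ->
  exists phi : nat -> nat, exists m, [/\ increasing_seq phi, D m &
    forall s, f (phi n) s @[n --> \oo] --> m s].
Proof.
move=> Df; have [phi phii phic] := helly (fun n => D_nondec (Df n))
  (fun n => D_01 (Df n)).
exists phi, (fun s => limn (fun n => f (phi n) s)).
have cv s : f (phi n) s @[n --> \oo] --> limn (fun n => f (phi n) s).
  exact: phic.
by split=> //; apply: D_closed cv.
Qed.

Lemma invSn_small (e : R) : 0 < e -> \forall n \near \oo, (n.+1%:R^-1 : R) <= e.
Proof.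
move=> e0; exists (Num.trunc e^-1) => // n /= Nn.
rewrite invf_ple ?posrE ?ltr0n// ltW// (lt_le_trans (truncnS_gt _))//.
by rewrite ler_nat ltnS.
Qed.

(** Kakutani's theorem with mixes instead of convex combinations. *)
Theorem mix_fixed_point m0 : D m0 -> exists2 m, D m & G m m.
Proof.
move=> Dm0.
have /choice[mN mNP] := fun N => approximate_fixed_point D_nondec D_01 D_mix
  G_nonempty G_sub Dm0 (ltn0Sn N).
have [phi [m [phii Dm mcvg]]] := D_select (fun N => (mNP N).1).
have mclose eta : 0 < eta -> \forall n \near \oo, close eta (mN (phi n)) m.
  move=> e0; apply: cvg_close => //; first by move=> n;
    apply/D_nondec/(mNP _).1.
  exact: D_nondec.
have phismall e : 0 < e -> \forall n \near \oo, ((phi n).+1%:R^-1 : R) <= e.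
  by move=> e0; exact: increasing_seq_cvg phii _ (invSn_small e0).
(* It suffices to approximate the limit m by elements of G m. If this fails for
   some delta, each late approximate fixed point involves some g, in G c with c
   close to m, that stays eta-away from G m; a limit of such g contradicts the
   closedness of the graph. *)
have claim delta : 0 < delta -> exists q, G m q /\ close delta q m.
  move=> d0; apply: contrapT => noq.
  pose eta := delta / 2; have eta0 : 0 < eta by rewrite /eta; lra.
  have [N0 _ N0P] : \forall n \near \oo, ((phi n).+1%:R^-1 : R) <= eta /\
      close eta (mN (phi n)) m.
    by apply: filterI; [exact: phismall|exact: mclose].
  have /choice[cg cgP] : forall n, exists cg : (R -> R) * (R -> R),
      [/\ D cg.1, G cg.1 cg.2, close ((phi (N0 + n)%N).+1%:R^-1 +
        (phi (N0 + n)%N).+1%:R^-1) cg.1 (mN (phi (N0 + n)%N)) &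
      forall h, G m h -> ~ close eta cg.2 h].
    move=> n; apply: contrapT => nocg; apply: noq.
    have [small mcl] := N0P (N0 + n)%N (leq_addr _ _).
    have [_ [I [th [g [c [mix th0 DG alt]]]]]] := mNP (phi (N0 + n)%N).
    have /choice[h hP] : forall j, exists h, G m h /\
        ((1 - eta < th j /\ 1 - eta < th j) \/
         (`|th j - th j| <= eta /\ close eta (g j) h)).
      move=> j; have [thj|cj] := alt j.
        have [h Gh] := G_nonempty Dm; exists h; split=> //; left.
        by split; apply: le_lt_trans thj; rewrite lerD2l lerN2.
      apply: contrapT => noh; apply: nocg; exists (c j, g j) => /=.
      have [Dc Gc] := DG j; split=> // h Gh ch; apply: noh; exists h.
      by split=> //; right; rewrite subrr normr0 (ltW eta0).
    have [q Gq mixq] := G_mix Dm th0 (fun j => (hP j).1).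
    exists q; split=> //; rewrite (splitr delta) -/eta.
    apply: (@close_trans _ _ _ _ (mN (phi (N0 + n)%N))); try exact: ltW.
      apply: close_sym; apply: (mix_close _ mix mixq (fun j => (hP j).2)).
      exact: ltW.
    exact: mcl.
  pose c n := (cg n).1; pose g n := (cg n).2.
  have Dg n : D (g n) by have [h1 h2 _ _] := cgP n; exact: G_sub h2.
  have [psi [gg [psii Dgg gcvg]]] := D_select Dg.
  have ccl e : 0 < e -> \forall n \near \oo, close e (c n) m.
    move=> e0; have e40 : 0 < e / 4 by lra.
    have shift : (fun n => (N0 + n)%N) @ \oo --> \oo.
      by apply: increasing_seq_cvg; apply/increasing_seqP => n;
        rewrite ltEnat/= addnS.
    near=> n.
    have [_ _ h1 _] := cgP n.
    have h2 : (phi (N0 + n)%N).+1%:R^-1 <= e / 4.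
      by near: n; exact: shift _ (phismall _ e40).
    have h3 : close (e / 4) (mN (phi (N0 + n)%N)) m.
      by near: n; exact: shift _ (mclose _ e40).
    have h4 := close_trans _ _ h1 h3.
    apply: close_le (h4 _ _); rewrite ?addr_ge0 ?invr_ge0 ?(ltW e40)//.
    by move: h2; move: (_^-1) => z; lra.
  have Ggg : G m gg.
    apply: (@G_closed (c \o psi) (g \o psi)) => //.
    - by move=> n; have [] := cgP (psi n).
    - move=> s s01 nj; apply: (close_cvg (D_nondec Dm) _ s01 nj) => e e0.
      exact: increasing_seq_cvg psii _ (ccl e e0).
    - by move=> s _ _; exact: gcvg.
  have [N1 _ N1P] : \forall n \near \oo, close eta (g (psi n)) gg.
    by apply: cvg_close => //; [move=> n; exact: D_nondec|exact: D_nondec].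
  have [_ _ _ bad] := cgP (psi N1); apply: (bad gg Ggg).
  exact: (N1P N1 (leqnn _)).
have /choice[q qP] : forall n : nat, exists q, G m q /\ close n.+1%:R^-1 q m.
  by move=> n; apply: claim; rewrite invr_gt0.
exists m => //; apply: (@G_closed (fun=> m) q) => //.
- by move=> n; have [] := qP n.
- by move=> s _ _; exact: cvg_cst.
- move=> s s01 nj; apply: (close_cvg (D_nondec Dm) _ s01 nj) => e e0.
  apply: filterS (invSn_small e0) => n ne; have [_] := qP n; exact: close_le.
Unshelve. all: by end_near. Qed.
End FixedPoint.

(** * Functions obtained from a monotone parametrisation *)

Lemma ptws_cvgP (S : Type) (T : topologicalType) (f : nat -> {ptws S -> T})
    (l : {ptws S -> T}) :
  (forall s, f n s @[n --> \oo] --> l s) -> f @ \oo --> l.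
Proof.
move=> fl; apply/cvg_sup => s U [/= _ [[V /= oV <- /= Vls]]] /filterS; apply.
by apply: (fl s); exact: open_nbhs_nbhs.
Qed.

Lemma patch_ifE (S T : Type) (f g : S -> T) (A : set S) s :
  patch f A g s = if s \in A then g s else f s.
Proof. by []. Qed.

(** Decomposable sets are stable under gluing along finite measurable covers. *)
Lemma decomposable_gluing (d : measure_display) (S : measurableType d)
    (T : topologicalType) (H : set {ptws S -> T}) (I : finType) (j0 : I)
    (g : I -> {ptws S -> T}) (A : I -> set S) (p : {ptws S -> T}) :
  decomposable H -> (forall j, measurable (A j)) -> (forall j, H (g j)) ->
  (forall j s, A j s -> p s = g j s) -> (forall s, exists j, A j s) -> H p.
Proof.
move=> decH mA Hg pg cov.
pose q js := foldr (fun j f => patch f (A j) (g j)) (g j0) js.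
have Hq js : H (q js) by elim: js => //= j js IH; apply: decH.
suff -> : p = q (enum I) by [].
apply/funext => s; have [j Aj] := cov s.
have : j \in enum I by rewrite mem_enum.
elim: (enum I) => //= i js IH; rewrite inE patch_ifE => jjs.
have [|nA] := boolP (s \in A i); first by rewrite inE => /pg.
by case/predU1P : jjs => [ij|/IH//]; move: nA; rewrite -ij notin_setE.
Qed.

Lemma countable_setU (T : Type) (A B : set T) :
  countable A -> countable B -> countable (A `|` B).
Proof.
move=> cA cB; rewrite -bigcup2E; apply: bigcup_countable => //.
by move=> [|[|n]] _ //=; exact/finite_set_countable/finite_set0.
Qed.

Section MonotoneParametrisation.
Context {R : realType} {d : measure_display} {S : measurableType d}.
Context {T : topologicalType} (mu : probability S R).
Variables (u : S -> R) (K : set R) (E : R -> S -> T).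
Hypothesis mu_meas : measurable_fun setT u.
Hypothesis u01 : forall s, 0 <= u s <= 1.
Hypothesis u_null : forall a, mu (u @^-1` [set a]) = 0%E.
Hypothesis K_closed : closed K.
Hypothesis K01 : forall a, K a -> 0 <= a <= 1.
Hypothesis E_cvg : forall (a : nat -> R) l s, (forall n, K (a n)) -> K l ->
  a @ \oo --> l -> E (a n) s @[n --> \oo] --> E l s.

(** The nondecreasing functions with values in [K]. *)
Definition mono_in : set (R -> R) := [set m | nondec m /\ forall s, K (m s)].

(** The function that [m] induces on [S] by means of [u] and [E]. *)
Definition along (m : R -> R) : {ptws S -> T} := fun s => E (m (u s)) s.

Definition monotone_family : set {ptws S -> T} := along @` mono_in.

Lemma mono_in01 m : mono_in m -> forall s, 0 <= m s <= 1.
Proof. by move=> [_ Km] s; exact: K01. Qed.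

Lemma mono_in_lim (f : nat -> R -> R) m : (forall n, mono_in (f n)) ->
  (forall s, f n s @[n --> \oo] --> m s) -> mono_in m.
Proof.
move=> Mf fm; split=> [s t st|s].
  have <- := cvg_lim (@Rhausdorff R) (fm s);
    have <- := cvg_lim (@Rhausdorff R) (fm t).
  apply: ler_lim; [by apply/cvg_ex; exists (m s)|by apply/cvg_ex;
    exists (m t)|].
  by apply: nearW => n; have [nd _] := Mf n; exact: nd.
apply: (closed_cvg K K_closed _ _ (fm s)); apply: nearW => n.
by have [_] := Mf n; exact.
Qed.

Lemma along_cvg (f : nat -> R -> R) m s : (forall n, mono_in (f n)) ->
  mono_in m ->
  f n (u s) @[n --> \oo] --> m (u s) ->
    along (f n) s @[n --> \oo] --> along m s.
Proof.
move=> Mf Mm fm; apply: (@E_cvg (fun n => f n (u s))) => //.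
  by move=> n; have [_] := Mf n; exact.
by have [_] := Mm; exact.
Qed.

Lemma monotone_family_seq_compact : seq_compact monotone_family.
Proof.
move=> v vY.
have /choice[f fP] : forall n, exists m, mono_in m /\ along m = v n.
  by move=> n; have [m Mm <-] := vY n; exists m.
have Mf n : mono_in (f n) by have [] := fP n.
have [phi phii phic] := helly (fun n => (Mf n).1) (fun n => mono_in01 (Mf n)).
pose m s := limn (fun n => f (phi n) s) : R.
have fm s : f (phi n) s @[n --> \oo] --> m s by exact: phic.
have Mm : mono_in m by apply: mono_in_lim fm => n; exact: Mf.
exists phi => //; exists (along m); first by exists m.
apply: ptws_cvgP => s /=.
rewrite (_ : (fun n => v (phi n) s) = (fun n => along (f (phi n)) s)).
  by apply: (along_cvg (f := f \o phi) _ Mm (fm _)) => n; exact: Mf.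
by apply/funext => n; have [_ ->] := fP (phi n).
Qed.

Lemma null_countable_preimage (Z : set R) : countable Z ->
  measurable (u @^-1` Z) /\ mu (u @^-1` Z) = 0%E.
Proof.
move=> cZ.
have mZ : measurable Z by apply: countable_measurable.
have muZ : measurable (u @^-1` Z) by rewrite -[X in measurable X]setTI;
  exact: mu_meas.
split=> //; apply/(negligibleP mu muZ).
have /pcard_surjP[j jP] := cZ.
apply: (@negligibleS _ _ _ _ (\bigcup_n (u @^-1` [set j n]))).
  by move=> s /= /jP[n _ jn]; exists n.
apply: negligible_bigcup => n; apply/negligibleP; last exact: u_null.
by rewrite -[X in measurable X]setTI; exact: mu_meas.
Qed.

(** The sets where the mix coincides with one of the functions are measurable,
    because nondecreasing functions are. *)
Lemma along_mix_mem (H : set {ptws S -> T}) (I : finType) (th : I -> R)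
    (g : I -> R -> R) m : decomposable H -> (forall j, mono_in (g j)) ->
  (forall j, H (along (g j))) -> mono_in m -> (exists j, th j <= 0) ->
  is_mix th g m -> H (along m).
Proof.
move=> decH Mg Hg Mm [j0 _] mix.
have mes m' : mono_in m' -> measurable_fun setT (m' \o u).
  move=> [nd _]; apply: measurableT_comp => //.
  exact: measurable_realfun.nondecreasing_measurable.
apply: (@decomposable_gluing _ _ _ H I j0 (along \o g)
   (fun j => [set s | m (u s) = g j (u s)])) => //.
- move=> j; rewrite (_ : [set s | _] = [set s | (m \o u) s == (g j \o u) s]).
    rewrite -[X in measurable X]setTI.
    exact: (measurable_realfun.measurable_fun_eqr (mes _ Mm) (mes _ (Mg j))).
  by apply/seteqP; split => s /= /eqP.
- by move=> j s /= e; rewrite /along e.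
- move=> s; have /andP[us0 _] := u01 s.
  by have [[j _ e] _] := mix _ us0; exists j.
Qed.

Lemma monotone_family_fixed_point : fixed_point_property mu monotone_family.
Proof.
move=> F B [Bsub decF decB] [Bnull Fcl Bcl] [f0 [[m0 Mm0 <-{f0}] Fm0]] Bne.
pose D : set (R -> R) := [set m | mono_in m /\ F (along m)].
pose G m : set (R -> R) := [set m' | mono_in m' /\ B (along m) (along m')].
have Dm0 : D m0 by [].
suff [m [Mm Fm] [_ Bm]] : exists2 m, D m & G m m.
  by exists (along m) => //; split=> //; exists m.
apply: (mix_fixed_point (G := G) _ _ _ _ _ _ _ _ Dm0).
- by move=> m [[]].
- by move=> m [/mono_in01].
- move=> I th g th0 Dg.
  have [m [nd Km mix]] := mix_exists (K := K) th0 (fun j => (Dg j).1.1)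
    (fun j => (Dg j).1.2).
  exists m => //; split=> //.
  apply: (along_mix_mem decF _ _ _ th0 mix) => // j; by have [] := Dg j.
- move=> m [Mm Fm] I th g th0 Gg.
  have [q [nd Kq mix]] := mix_exists (K := K) th0 (fun j => (Gg j).1.1)
    (fun j => (Gg j).1.2).
  exists q => //; split=> //.
  apply: (along_mix_mem (decB _ Fm) _ _ _ th0 mix) => // j; by have [] := Gg j.
- move=> m [Mm Fm].
  have [|f [[g Mg <-] Bg]] := Bne (along m); first by split=> //; exists m.
  by exists g.
- by move=> m g [Mm Fm] [Mg Bg]; split=> //; exact: Bsub Bg.
- move=> f m Df fm.
  have Mm : mono_in m by apply: mono_in_lim fm => n; have [] := Df n.
  split=> //; apply: (Fcl (fun n => along (f n))) => //.
    by move=> n; have [] := Df n.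
  by apply: ptws_cvgP => s; apply: along_cvg => // n; have [] := Df n.
- move=> f g m m' fgP [Mm Fm] [Mm' Fm'] fm gm'.
  split=> //.
  (* The convergence may fail where u takes a value at a jump or an end point.
     This set is null, so all the functions may be replaced there by their
     limits. *)
  pose Z := [set s | jump m s] `|` [set s | jump m' s] `|` [set 0; 1].
  have cZ : countable Z.
    apply: countable_setU; first apply: countable_setU.
    - by apply: jump_countable; case: Mm.
    - by apply: jump_countable; case: Mm'.
    - exact/finite_set_countable.
  have [mN N0] := null_countable_preimage cZ.
  set N := u @^-1` Z in mN N0.
  pose f' n : {ptws S -> T} := patch (along (f n)) N (along m).
  pose g' n : {ptws S -> T} := patch (along (g n)) N (along m').
  have Mf n : mono_in (f n) by have [[]] := fgP n.
  have Ff n : F (along (f n)) by have [[]] := fgP n.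
  have Mg n : mono_in (g n) by have [_ []] := fgP n.
  have Bfg n : B (along (f n)) (along (g n)) by have [_ []] := fgP n.
  have Ff' n : F (f' n) by apply: decF.
  have B1 n : B (f' n) (along (g n)).
    by have [] := Bnull N _ _ mN N0 (Ff n) (Bfg n) _ Fm.
  have B2 n : B (f' n) (g' n).
    by have [] := Bnull N _ _ mN N0 (Ff' n) (B1 n) _ Fm'.
  have out s : s \notin N -> [/\ 0 < u s < 1, ~ jump m (u s) & ~ jump m' (u s)].
    rewrite notin_setE => nN; split; last 2 first.
    - by move=> jm; apply: nN; left; left.
    - by move=> jm; apply: nN; left; right.
    have /andP[h0 h1] := u01 s; rewrite !lt_neqAle h0 h1 !andbT.
    apply/andP; split; apply/eqP => e; apply: nN; right; [by left|by right].
  have patch_cvg (h : nat -> R -> R) m1 : (forall n, mono_in (h n)) ->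
    mono_in m1 ->
      (forall s, s \notin N -> h n (u s) @[n --> \oo] --> m1 (u s)) ->
      (fun n => patch (along (h n)) N (along m1) : {ptws S ->
        T}) @ \oo --> along m1.
    move=> Mh Mm1 hm; apply: ptws_cvgP => s.
    have [sN|sN] := boolP (s \in N).
      rewrite (_ : (fun n => _) = (fun=> along m1 s)); first exact: cvg_cst.
      by apply/funext => n; rewrite patch_ifE sN.
    rewrite (_ : (fun n => _) = (fun n => along (h n) s)).
      exact: along_cvg (hm s sN).
    by apply/funext => n; rewrite patch_ifE (negbTE sN).
  have [] : graph_on F B (along m, along m').
    apply: (Bcl (fun n => (f' n, g' n))).
    - by move=> n; split => /=.
    - by [].
    - have cf : f' @ \oo --> along m.
        by apply: patch_cvg => // s sN; have [s01 j1 _] := out s sN; exact: fm.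
      have cg : g' @ \oo --> along m'.
        by apply: patch_cvg => // s sN; have [s01 _ j2] := out s sN; exact: gm'.
      exact: cvg_pair cf cg.
  by [].
Qed.
End MonotoneParametrisation.

(** * Parametrisation of compact metrizable sets *)

Section Ternary.
Context {R : realType}.
Implicit Types b : nat -> bool.

Fixpoint ternary_approx (n : nat) b : R :=
  if n is n'.+1 then ((b 0%N)%:R * 2 + ternary_approx n' (b \o S)) / 3 else 0.

(** The point of the Cantor set with ternary digits [2 * b i]. *)
Definition ternary b : R := limn (fun n => ternary_approx n b).

Lemma ternary_approxS n b :
  ternary_approx n.+1 b = ((b 0%N)%:R * 2 + ternary_approx n (b \o S)) / 3.
Proof. by []. Qed.

Lemma bool_natr01 (c : bool) : 0 <= (c%:R : R) <= 1.
Proof. by case: c; rewrite ?lexx ler01. Qed.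

Lemma ternary_approx01 n b : 0 <= ternary_approx n b <= 1.
Proof.
elim: n b => [|n IH] b /=; first by rewrite lexx ler01.
have /andP[h1 h2] := IH (b \o S); have /andP[h3 h4] := bool_natr01 (b 0%N).
by move: h1 h2 h3 h4; move: (ternary_approx _ _) (_%:R) => x y *; lra.
Qed.

Lemma ternary_approx_nondec n b : ternary_approx n b <= ternary_approx n.+1 b.
Proof.
elim: n b => [|n IH] b; first by have /andP[] := ternary_approx01 1 b.
have := IH (b \o S) => h.
rewrite (ternary_approxS n b) (ternary_approxS n.+1 b).
by move: h; move: (ternary_approx _ _) (ternary_approx _ _) (_%:R) => x y z *;
  lra.
Qed.

Lemma ternary_cvg b : ternary_approx n b @[n --> \oo] --> ternary b.
Proof.
apply: nondecreasing_is_cvgn.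
  by apply/nondecreasing_seqP => n; exact: ternary_approx_nondec.
by exists 1 => _ [n _ <-]; have /andP[] := ternary_approx01 n b.
Qed.

Lemma ternary01 b : 0 <= ternary b <= 1.
Proof.
apply/andP; split; [apply: limr_ge|apply: limr_le];
  do ?[by apply/cvg_ex; exists (ternary b); exact: ternary_cvg];
  by apply: nearW => n; have /andP[] := ternary_approx01 n b.
Qed.

(** Self-similarity, from which all the estimates follow by induction. *)
Lemma ternaryE b : ternary b = ((b 0%N)%:R * 2 + ternary (b \o S)) / 3.
Proof.
have : ternary_approx n.+1 b @[n --> \oo] --> ((b 0%N)%:R * 2 + ternary (b \o
  S)) / 3.
  apply: cvgMl; apply: cvgD; first exact: cvg_cst.
  exact: ternary_cvg.
move/(cvg_lim (@Rhausdorff R)) => <-.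
apply/esym/(cvg_lim (@Rhausdorff R)).
have := @ternary_cvg b; rewrite -(cvg_shiftS (fun n => ternary_approx n b)).
by [].
Qed.

Lemma ternary_near n b c : (forall i, (i < n)%N -> b i = c i) ->
  `|ternary b - ternary c| <= 3^-1 ^+ n.
Proof.
elim: n b c => [|n IH] b c bc.
  have /andP[h1 h2] := ternary01 b; have /andP[h3 h4] := ternary01 c.
  by rewrite expr0 ler_norml; apply/andP; split; lra.
have := IH (b \o S) (c \o S) (fun i ilt => bc i.+1 ilt).
rewrite (ternaryE b) (ternaryE c) (bc 0%N)// exprS.
move: (ternary _) (ternary _) (_%:R) (_ ^+ n) => x y z w.
by rewrite !ler_norml => /andP[h1 h2]; apply/andP; split; lra.
Qed.

Lemma ternary_sep n b c : `|ternary b - ternary c| < 3^-1 ^+ n ->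
  forall i, (i < n)%N -> b i = c i.
Proof.
elim: n b c => [//|n IH] b c; rewrite (ternaryE b) (ternaryE c) exprS => H.
have /andP[h1 h2] := ternary01 (b \o S);
  have /andP[h3 h4] := ternary01 (c \o S).
have w0 : 0 <= 3^-1 ^+ n :> R by rewrite exprn_ge0// invr_ge0.
have w1 : 3^-1 ^+ n <= 1 :> R by rewrite exprn_ile1// ?invr_ge0// invf_le1//;
  lra.
have bc0 : b 0%N = c 0%N.
  move: H h1 h2 h3 h4 w0 w1.
  move: (ternary _) (ternary _) (_ ^+ n) => x y w.
  rewrite ltr_norml => /andP[H1 H2].
  by case: (b 0%N) H1 H2; case: (c 0%N) => //= H1 H2 *; exfalso; lra.
have H' : `|ternary (b \o S) - ternary (c \o S)| < 3^-1 ^+ n.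
  move: H; rewrite bc0; move: (ternary _) (ternary _) (_ ^+ n) (_%:R) =>
    x y w z.
  by rewrite !ltr_norml => /andP[H1 H2]; apply/andP; split; lra.
by case=> [//|i]; rewrite ltnS; exact: (IH _ _ H').
Qed.

Lemma ternary_inj : injective ternary.
Proof.
move=> b c e; apply/funext => i; apply: (@ternary_sep i.+1) => //.
by rewrite e subrr normr0 exprn_gt0// invr_gt0.
Qed.

Lemma third_small (e : R) : 0 < e -> exists n, 3^-1 ^+ n < e.
Proof.
move=> e0; have : (fun n => 3^-1 ^+ n : R) @ \oo --> (0 : R).
  by apply: cvg_expr; rewrite ger0_norm ?invr_ge0// invf_lt1//; lra.
move/cvgrPdist_lt/(_ e e0) => [n _ /(_ n (leqnn n))].
by rewrite sub0r normrN ger0_norm ?exprn_ge0 ?invr_ge0// => h; exists n.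
Qed.

Lemma ternary_cvg_bits (b : nat -> nat -> bool) c :
  ternary (b n) @[n --> \oo] --> ternary c ->
  forall i, \forall n \near \oo, b n i = c i.
Proof.
move=> /cvgrPdist_lt bc i.
have e0 : 0 < 3^-1 ^+ i.+1 :> R by rewrite exprn_gt0// invr_gt0.
by apply: filterS (bc _ e0) => n h; apply/esym/(ternary_sep h).
Qed.

Lemma ternary_continuous : continuous (ternary : cantor_space -> R).
Proof.
move=> b; apply/cvgrPdist_le => e e0; have [n ne] := third_small e0.
have : nbhs b [set c : cantor_space | forall i : 'I_n, c (val i) = b (val i)].
  apply: (@filter_forall _ _
    (fun i : 'I_n => [set c : cantor_space | c (val i) = b (val i)])
    (nbhs b) (@nbhs_filter cantor_space b)) => i.
  apply: (@proj_continuous nat (fun=> bool) i b [set x | x = b (val i)]).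
  by apply: open_nbhs_nbhs; split; first exact: discrete_open.
by apply: (@filterS _ _ (@nbhs_filter cantor_space b)) => c h;
  apply: le_trans (ltW ne); apply: ternary_near => j jn;
  rewrite (h (Ordinal jn)).
Qed.

Lemma measurable_ternary (d : measure_display) (S : measurableType d)
    (A : nat -> set S) : (forall i, measurable (A i)) ->
  measurable_fun setT (fun s => ternary (fun i => s \in A i)).
Proof.
move=> mA; apply: (measurable_realfun.measurable_fun_cvg
  (h := fun n s => ternary_approx n (fun i => s \in A i))); last first.
  by move=> s _; exact: ternary_cvg.
move=> n; elim: n A mA => [|n IH] A mA /=; first exact: measurable_cst.
apply: measurable_realfun.measurable_funM => //;
  apply: measurable_realfun.measurable_funD.
  apply: measurable_realfun.measurable_funM => //.
  exact: measurable_realfun.measurable_indic (mA 0%N).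
exact: (IH (fun i => A i.+1) (fun i => mA i.+1)).
Qed.

End Ternary.

(** Compactness of a set in its ambient space, seen in the subspace. *)
Lemma compact_set_type (T : topologicalType) (X : set T) :
  compact X -> compact [set: set_type X].
Proof.
move=> cX F PF _.
have [|p [Xp clp]] := cX (set_val @ F) _.
  by apply: (@filterS _ F _ setT) => [q _|]; [exact: set_valP|exact: filterT].
exists (SigSub (mem_set Xp)); split=> // A B FA.
rewrite nbhsE => -[W [[V oV <-{W}] Vp] VB].
have FA' : (set_val @ F) (set_val @` A).
  by apply: (@filterS _ F _ A) => // z Az; exists z.
have [_ [[z Az <-] Vz]] := clp _ _ FA' (open_nbhs_nbhs (conj oV Vp)).
by exists z; split=> //; exact: VB.
Qed.

Section MetricCopy.
Context {R : realType} {X : choiceType} (dist : X -> X -> R).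
(** A copy of [X] carrying the topology of the distance [dist], pointed at
    [x0]. *)
Definition metric_copy (x0 : X) (d0 : forall x, dist x x = 0)
  (dpos : forall x y, dist x y = 0 -> x = y)
  (dsym : forall x y, dist x y = dist y x)
  (dtri : forall y x z, dist x z <= dist x y + dist y z) : Type := X.
Variables (x0 : X) (d0 : forall x, dist x x = 0)
  (dpos : forall x y, dist x y = 0 -> x = y)
  (dsym : forall x y, dist x y = dist y x)
  (dtri : forall y x z, dist x z <= dist x y + dist y z).
HB.instance Definition _ := Choice.on (metric_copy x0 d0 dpos dsym dtri).
HB.instance Definition _ := isPointed.Build (metric_copy x0 d0 dpos dsym dtri)
  x0.
HB.instance Definition _ := isMetric.Build R (metric_copy x0 d0 dpos dsym dtri)
  d0 dpos dsym dtri.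
End MetricCopy.

(** The Alexandroff-Hausdorff theorem for a topology given by a distance. *)
Lemma cantor_onto (R : realType) (X : topologicalType) (x0 : X) :
  compact [set: X] -> metrizable R X ->
  exists f : cantor_space -> X, continuous f /\ forall x, exists b, f b = x.
Proof.
move=> cX [dist [d0 _ dsym dtri nbhsX]].
pose M : metricType R := metric_copy x0 (fun x => (d0 x x).2 erefl)
  (fun x y => (d0 x y).1) dsym (fun y x z => dtri x y z).
pose Mp : pseudoPMetricType R := metric_copy x0 (fun x => (d0 x x).2 erefl)
  (fun x y => (d0 x y).1) dsym (fun y x z => dtri x y z).
have nbhsE (x : X) : nbhs (x : M) = nbhs x.
  by rewrite nbhsX -metricType_numDomainType.nbhs_nbhs_mdist.
have cM : compact [set: Mp].
  move=> F PF FT; have [p [_ clp]] := cX F PF FT.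
  exists p; split=> // A B FA; rewrite [nbhs _]nbhsE; exact: clp.
have hM : hausdorff_space Mp := @metric_hausdorff R M.
have [f fc] := cantor_surj cM hM.
exists f; split.
  by move=> b; have := fc b; rewrite /continuous_at [nbhs (f b)]nbhsE.
by move=> x; have [b _ <-] := @surj _ _ _ _ f x I; exists b.
Qed.

Lemma real_parametrisation (R : realType) (S : choiceType) (T : topologicalType)
    (X : set {ptws S -> T}) : compact X -> metrizable R X -> X !=set0 ->
  exists (K : set R) (E : R -> S -> T),
    [/\ closed K, forall a, K a -> 0 <= a <= 1,
      forall (a : nat -> R) l s, (forall n, K (a n)) -> K l ->
        a @ \oo --> l -> E (a n) s @[n --> \oo] --> E l s &
      forall x, X x -> exists2 a, K a & E a = x].
Proof.
move=> cX mX [x0 Xx0].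
pose x1 : set_type X := SigSub (mem_set Xx0).
have [f [fc fsurj]] := @cantor_onto R (set_type X) x1 (compact_set_type cX) mX.
pose K : set R := range (ternary : cantor_space -> R).
pose bits (a : R) : cantor_space := get [set b : cantor_space | ternary b = a].
have bitsK a : K a -> ternary (bits a) = a.
  by move=> [b _ e]; rewrite /bits; case: xgetP => [c _ //|/(_ b)].
pose E (a : R) : {ptws S -> T} := set_val (f (bits a)).
exists K, E; split.
- apply: compact_closed; first exact: Rhausdorff.
  apply: continuous_compact; last exact: cantor_space_compact.
  by apply: continuous_subspaceT; exact: ternary_continuous.
- by move=> _ [b _ <-]; exact: ternary01.
- move=> a l s Ka Kl al.
  have cb : (fun n => bits (a n)) @ \oo --> bits l.
    apply: ptws_cvgP => i.
    have h : \forall n \near \oo, bits (a n) i = bits l i.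
      apply: (@ternary_cvg_bits R (fun n => bits (a n)) (bits l));
        rewrite bitsK//.
      by rewrite (_ : (fun n => _) = a)//; apply/funext => n; rewrite bitsK.
    exact: cvg_near_cst h.
  have cf : (fun n => f (bits (a n))) @ \oo --> f (bits l).
    exact: (cvg_comp _ _ cb (fc (bits l))).
  have cE : (fun n => E (a n)) @ \oo --> E l.
    apply: (cvg_comp _ _ cf).
    exact: (@initial_continuous (set_type X) {ptws S ->
      T} set_val (f (bits l))).
  exact: (cvg_comp (fun n => E (a n)) (fun h : {ptws S -> T} => h s) cE
    (@proj_continuous S (fun=> T) s (E l))).
- move=> x Xx; have [b bx] := fsurj (SigSub (mem_set Xx)).
  exists (ternary b); first by exists b.
  rewrite /E (_ : bits (ternary b) = b) ?bx//.
  by apply: (@ternary_inj R); rewrite bitsK//; exists b.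
Qed.

(** * A coordinate with null level sets on an atomless space *)

Section Atomless.
Context {R : realType} {d : measure_display} {S : measurableType d}.
Variable mu : probability S R.
Hypothesis mu_atomless : atomless mu.

Definition mass (A : set S) : R := fine (mu A).

Lemma massE A : measurable A -> mu A = (mass A)%:E.
Proof. by move=> mA; rewrite /mass fineK// fin_num_measure. Qed.

Lemma mass_ge0 A : 0 <= mass A.
Proof. exact: fine_ge0. Qed.

Lemma mass_le1 A : measurable A -> mass A <= 1.
Proof. by move=> mA; rewrite -lee_fin -massE//; exact: probability_le1. Qed.

Lemma le_mass A B : measurable A -> measurable B -> A `<=` B ->
  mass A <= mass B.
Proof.
move=> mA mB AB; rewrite -lee_fin -!massE//; apply: le_measure => //;
  exact: mem_set.
Qed.

Lemma massD A B : measurable A -> measurable B -> B `<=` A ->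
  mass (A `\` B) = mass A - mass B.
Proof.
move=> mA mB BA; apply: EFin_inj; rewrite EFinB -!massE//;
  last exact: measurableD.
rewrite measureD//; first by rewrite setIidr.
exact: le_lt_trans (probability_le1 mu mA) (ltry 1).
Qed.

(** A set of positive mass can be split repeatedly, keeping the lighter part. *)
Lemma small_subset A n : measurable A -> 0 < mass A ->
  exists B, [/\ measurable B, B `<=` A, 0 < mass B & mass B <= 2^-1 ^+ n].
Proof.
move=> mA A0; elim: n => [|n [B [mB BA B0 Bn]]].
  by exists A; split=> //; exact: mass_le1.
have [|C [mC CB C0 CltB]] := mu_atomless mB; first by rewrite massE ?lte_fin.
have C0' : 0 < mass C by rewrite -lte_fin -massE.
have CltB' : mass C < mass B by rewrite -lte_fin -!massE.
have BC := massD mB mC CB.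
have [h|h] := leP (mass C) (mass B / 2).
  exists C; split=> //; first exact: subset_trans BA.
  by rewrite exprS mulrC; apply: le_trans h _; rewrite ler_pM2r ?invr_gt0.
exists (B `\` C); split; first exact: measurableD.
- by move=> x [/BA].
- by rewrite BC subr_gt0.
- by rewrite exprS; move: Bn; move: (_ ^+ n) => z Bn; rewrite BC; lra.
Qed.

(** Greedy choice: each set has at least half of the largest possible mass among
    the small sets disjoint from the previous ones. What remains is null, since
    otherwise it would contain a small set of positive mass, which would bound
    from below the mass of all the chosen sets. *)
Lemma small_cover n : exists B : nat -> set S,
  [/\ forall i, measurable (B i), forall i, mass (B i) <= 2^-1 ^+ n &
      mu (~` \bigcup_i B i) = 0%E].
Proof.
pose ok (A B : set S) := [/\ measurable B, B `<=` A & mass B <= 2^-1 ^+ n].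
have greedy A : measurable A -> exists B, ok A B /\
    forall B', ok A B' -> mass B' <= 2 * mass B.
  move=> mA; pose M := mass @` [set B | ok A B].
  have ok0 : ok A set0.
    split; [exact: measurable0|exact: sub0set|].
    by rewrite /mass measure0 exprn_ge0// invr_ge0.
  have supM : has_sup M.
    split; first by exists (mass set0), set0.
    by exists (2^-1 ^+ n) => _ [B [_ _ h] <-].
  have ubM B' : ok A B' -> mass B' <= sup M.
    by move=> okB'; apply: sup_upper_bound => //; exists B'.
  have [s0|s0] := leP (sup M) 0.
    exists set0; split=> // B' /ubM h.
    apply: le_trans h (le_trans s0 _); by rewrite mulr_ge0// mass_ge0.
  have [|_ [B okB <-] hB] := @sup_adherent _ M (sup M / 2) _ supM; first lra.
  by exists B; split=> // B' /ubM h; lra.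
have [next nextP] : exists next : set S -> set S, forall A, measurable A ->
    ok A (next A) /\ forall B', ok A B' -> mass B' <= 2 * mass (next A).
  have /choice[f fP] : forall A, exists B, measurable A -> ok A B /\
    forall B', ok A B' -> mass B' <= 2 * mass B.
    move=> A; have [mA|nA] := pselect (measurable A); last by exists set0.
    by have [B] := greedy A mA; exists B.
  by exists f.
pose rest := fix rest i := if i is i'.+1 then rest i' `\` next (rest i')
  else setT.
have mrest i : measurable (rest i).
  elim: i => [|i IH] /=; first exact: measurableT.
  by apply: measurableD => //; have [[]] := nextP _ IH.
have restS i : next (rest i) `<=` rest i by have [[]] := nextP _ (mrest i).
have mnext i : measurable (next (rest i)) by have [[]] := nextP _ (mrest i).
exists (fun i => next (rest i)); split=> //.
  by move=> i; have [[]] := nextP _ (mrest i).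
set L := ~` _; have mL : measurable L by apply/measurableC/bigcup_measurable.
have Lrest i : L `<=` rest i.
  elim: i => [//|i IH] x Lx; split; first exact: IH.
  by move=> nx; apply: Lx; exists i.
have [L0|L0] := leP (mass L) 0.
  by rewrite massE//; congr (_%:E); apply/le_anti; rewrite L0 mass_ge0.
exfalso; have [C [mC CL C0 Cn]] := small_subset n mL L0.
have big i : mass C <= 2 * mass (next (rest i)).
  have [_ h] := nextP _ (mrest i); apply: h; split=> //.
  exact: subset_trans (Lrest i).
have shrink i : mass (rest i) <= 1 - i%:R * (mass C / 2).
  elim: i => [|i IH]; first by rewrite mul0r subr0; exact: mass_le1.
  rewrite [mass _](massD (mrest i) (mnext i) (restS i)) -natr1 mulrDl.
  by have := big i; lra.
pose N := (Num.trunc (2 / mass C)).+1.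
have : 2 / mass C < N%:R by exact: truncnS_gt.
rewrite ltr_pdivrMr// => HN.
by have := shrink N; have := mass_ge0 (rest N); lra.
Qed.

(** The coordinate of a point records, in its ternary digits, the sets of
    countably many covers to which the point belongs. *)
Lemma atomless_coordinate : exists u : S -> R,
  [/\ measurable_fun setT u, forall s, 0 <= u s <= 1 &
      forall a, mu (u @^-1` [set a]) = 0%E].
Proof.
have /choice[B BP] := small_cover.
pose A k : set S := if @unpickle (nat * nat)%type k is Some p
  then B p.1 p.2 else set0.
have mA k : measurable (A k).
  by rewrite /A; case: unpickle => [p|//]; have [] := BP p.1.
pose u s : R := ternary (fun k => s \in A k).
have mu_u : measurable_fun setT u by exact: measurable_ternary.
exists u; split=> //; first by move=> s; exact: ternary01.
move=> a; set L := u @^-1` _.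
have mL : measurable L by rewrite -[L]setTI; exact: mu_u.
have small (C : set S) : measurable C -> L `<=` C -> mass L <= mass C.
  by move=> mC; exact: le_mass.
suff L0 : mass L <= 0.
  by rewrite massE//; congr (_%:E); apply/le_anti; rewrite L0 mass_ge0.
have [->|/set0P[s0 Ls0]] := eqVneq L set0; first by rewrite /mass measure0.
have same t n i : L t -> (t \in B n i) = (s0 \in B n i).
  move=> Lt; have /(@ternary_inj R) e : u t = u s0 by rewrite Lt Ls0.
  by have := congr1 (fun b : nat -> bool => b (pickle (n, i))) e;
    rewrite /A pickleK.
have [H|/existsNP[n nH]] := pselect (forall n, exists i, s0 \in B n i).
  rewrite leNgt; apply/negP => L0.
  have : (fun n => 2^-1 ^+ n : R) @ \oo --> (0 : R).
    by apply: cvg_expr; rewrite ger0_norm ?invr_ge0// invf_lt1//; lra.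
  move/cvgrPdist_lt/(_ _ L0) => [n _ /(_ n (leqnn n))].
  rewrite sub0r normrN ger0_norm ?exprn_ge0 ?invr_ge0// ltNge => /negP; apply.
  have [i s0i] := H n; have [mB Bn _] := BP n.
  apply: le_trans (Bn i); apply: small => // t Lt.
  by apply: set_mem; rewrite (same t n i Lt).
have [mB _ B0] := BP n.
have : mass L <= mass (~` \bigcup_i B n i).
  apply: small; first by apply/measurableC/bigcup_measurable.
  move=> t Lt [i _ Bt]; apply: nH; exists i.
  by rewrite -(same t n i Lt); exact: mem_set.
by rewrite [mass (~` _)]/mass B0.
Qed.
End Atomless.

Local Close Scope ring_scope.

(** * The theorem *)

Theorem theorem2p2 (R : realType) (d : measure_display) (S : measurableType d)
    (mu : probability S R) (T : topologicalType) :
  atomless mu -> [set: T] !=set0 ->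
  forall X : set {ptws S -> T}, compact X -> metrizable R X ->
  exists Y : set {ptws S -> T},
    [/\ X `<=` Y, seq_compact Y & fixed_point_property mu Y].
Proof.
move=> mu_atomless _ X cX mX.
have [->|/set0P X0] := eqVneq X set0.
  exists set0; split=> //; first by move=> v /(_ 0%N).
  by move=> F B _ _ [f []].
have [K [E [K_closed K01 E_cvg XE]]] := real_parametrisation cX mX X0.
have [u [u_meas u01 u_null]] := atomless_coordinate mu_atomless.
exists (monotone_family u K E); split.
- move=> _ /XE[a Ka <-]; exists (fun=> a) => //.
  by split=> // s t _; exact: lexx.
- exact: monotone_family_seq_compact.
- exact: monotone_family_fixed_point.
Qed.
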